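(* Let $f(x)=h(c(x))$, where $c:\mathbb{R}^n\to\mathbb{R}^m$ is $C^1$-smooth with $\beta$-Lipschitz continuous $\nabla c$ ($\beta>0$), and $h:\mathbb{R}^m\to\mathbb{R}$ is convex, $L$-Lipschitz continuous ($L>0$), with $\inf_y h(y)>-\infty$. Assume there is a constant $\delta_0>0$ such that $$x\in(\partial f)^{-1}(0),\ y\in(\partial f)^{-1}(0),\ f(x)\ne f(y)\ \Longrightarrow\ \|x-y\|\ge\delta_0.$$ Let $\{x^k\}$ be a sequence generated by the adaptive descent-oriented subgradient method (described in the context, with zero optimality tolerances) applied to $f$ with $$G(x,\epsilon)=\Big\{\nabla c(x)\,y\ \Big|\ y\in\operatorname{argmax}_{y\in\operatorname{dom}(h^* )}\big\{y^\top c(x)-h^*(y)-\tfrac{\epsilon}{2}\|\nabla c(x)\,y\|^2\big\}\Big\}.$$ Suppose that the level set $X=\{x\in\mathbb{R}^n\mid f(x)\le f(x^0)\}$ is compact, and that $\partial f$ is metrically subregular at $(\bar x,0)$ for every $\bar x\in(\partial f)^{-1}(0)\cap X$. Then for all sufficiently large $k$ the function values $f(x^k)$ and the iterates $x^k$ converge linearly; that is, there exist $\bar x\in\mathbb{R}^n$, $q\in(0,1)$, $\rho\in(0,1)$, $C>0$ and $r\in\mathbb{N}$ such that for all $k\ge r$, $$f(x^{k+1})-f(\bar x)\le q\,\big(f(x^k)-f(\bar x)\big)\qquad\text{and}\qquad\|x^k-\bar x\|\le C\rho^{k}.$$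
   Context: $\|\cdot\|$ is the Euclidean norm; $\nabla c(x)\in\mathbb{R}^{n\times m}$ is the transpose of the Jacobian matrix of $c$ at $x$; $h^*$ is the convex conjugate of $h$ and $\operatorname{dom}(h^* )$ its effective domain; $\partial f$ is the Clarke subdifferential and $(\partial f)^{-1}(0)=\{x\in\mathbb{R}^n\mid 0\in\partial f(x)\}$. A set-valued mapping $S:\mathbb{R}^n\rightrightarrows\mathbb{R}^m$ is metrically subregular at $(\bar x,\bar y)\in\operatorname{gph}S$ if there exist $\kappa,\tau>0$ with $\operatorname{dist}(x,S^{-1}(\bar y))\le\kappa\cdot\operatorname{dist}(\bar y,S(x))$ for all $x$ with $\|x-\bar x\|<\tau$. Adaptive descent-oriented subgradient method (with $\epsilon_{\rm tol}=\nu_{\rm tol}=0$, so no early return occurs). Input: $x^0\in\mathbb{R}^n$, $\epsilon_{0,0}>0$, a sequence of positive numbers $\{a_t\}$ decreasing to $0$ with $\sum_t a_t=+\infty$, $\nu_0>0$, $\theta_\epsilon,\theta_\nu\in(0,1)$, $\alpha\in(0,1)$, and a counter initialized as $t=0$. For $k=0,1,\dots$, given $x^k,\epsilon_{k,0},\nu_k$ and the current value of $t$: 1. (Inner loop) For $i=0,1,\dots$: set $\epsilon_{k,i}=\epsilon_{k,0}2^{-i}$ and choose any $g^{k,i}\in G(x^k,\epsilon_{k,i})$. If some $j\in\{0,1,\dots,i\}$ satisfies $f(x^k-\eta g^{k,i})\le f(x^k)-\alpha\eta\|g^{k,i}\|^2$ with $\eta=\epsilon_{k,0}2^{-j}$,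 take the smallest such $j$, set $i_k=i$, let $\eta_k$ be a minimizer of $\eta\mapsto f(x^k-\eta g^{k,i})$ over the finite set $\{\epsilon_{k,0}2^{-j},\epsilon_{k,0}2^{-j-1},\dots,\epsilon_{k,0}2^{-i}\}$, and terminate the inner loop; otherwise continue with $i+1$. 2. Set $x^{k+1}=x^k-\eta_k g^{k,i_k}$. 3. If $\|g^{k,i_k}\|\le\nu_k$: replace $t$ by $t+1$; set $\tilde\epsilon_k=(a_t)^{1/4}$ and choose any $\tilde g^k\in G(x^k,\tilde\epsilon_k)$; set $\nu_{k+1}=\theta_\nu\nu_k$; (ratio test) if $\epsilon_{k,0}\,\tilde\epsilon_k\|\tilde g^k\|\le(\epsilon_{k,i_k}\|g^{k,i_k}\|)^{1/2}$ set $\epsilon_{k+1,0}=\epsilon_{k,0}$, else set $\epsilon_{k+1,0}=\theta_\epsilon\epsilon_{k,0}$. Otherwise (if $\|g^{k,i_k}\|>\nu_k$): set $\epsilon_{k+1,0}=\epsilon_{k,0}$ and $\nu_{k+1}=\nu_k$. *)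

(* Defs.v *)
From HB Require Import structures.
From mathcomp Require Import all_boot all_order all_algebra.
From mathcomp Require Import all_classical all_reals all_analysis.
Import Order.TTheory GRing.Theory Num.Theory.
Import numFieldNormedType.Exports.

Set Implicit Arguments.
Unset Strict Implicit.
Unset Printing Implicit Defensive.

Local Open Scope classical_set_scope.
Local Open Scope ring_scope.

(* The library's norm [`|v|] on ['rV[R]_n] is the max norm, hence the          *)
(* Euclidean norm below; the topologies agree, so [compact], [continuous] and  *)
(* [differentiable] are the library's.                                         *)
Section Euclidean.
Context {R : realType}.

Definition dot n (u v : 'rV[R]_n) : R := \sum_(i < n) u 0 i * v 0 i.

Definition enorm n (v : 'rV[R]_n) : R := Num.sqrt (dot v v).

(* Distance to a set; the distance to the empty set is [+oo]. *)
Definition edist_set n (x : 'rV[R]_n) (A : set 'rV[R]_n) : \bar R :=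
  ereal_inf [set (enorm (x - z))%:E | z in A].

(* Points are row vectors, so the matrix-vector product A y is [y *m A^T]. *)
Definition mxvmul n m (A : 'M[R]_(n, m)) (y : 'rV[R]_m) : 'rV[R]_n :=
  y *m A^T.

Definition opnorm n m (A : 'M[R]_(n, m)) : R :=
  sup [set enorm (mxvmul A y) | y in [set y | enorm y <= 1]].

End Euclidean.

Section VariationalAnalysis.
Context {R : realType}.

(* The library's ['J c x] acts on row vectors on the right,                    *)
(* ['D_v c x = v *m 'J c x], so it is the n x m transpose of the usual Jacobian *)
(* matrix.                                                                     *)
Definition grad n m (c : 'rV[R]_n -> 'rV[R]_m) (x : 'rV[R]_n) : 'M[R]_(n, m) :=
  'J c x.

Definition C1 n m (c : 'rV[R]_n -> 'rV[R]_m) : Prop :=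
  (forall x, differentiable c x) /\ continuous (grad c).

Definition convex_conj m (h : 'rV[R]_m -> R) (y : 'rV[R]_m) : \bar R :=
  ereal_sup [set (dot y u - h u)%:E | u in [set: 'rV[R]_m]].

(* The conjugate of a real-valued function never takes the value [-oo]. *)
Definition edom m (phi : 'rV[R]_m -> \bar R) : set 'rV[R]_m :=
  [set y | (phi y < +oo)%E].

Definition argmax T (A : set T) (F : T -> \bar R) : set T :=
  [set y | A y /\ forall z, A z -> (F z <= F y)%E].

(* limsup of (f (y + t d) - f y) / t as y -> x and t -> 0+. *)
Definition clarke_dirderiv n (f : 'rV[R]_n -> R) (x d : 'rV[R]_n) : \bar R :=
  limf_esup (fun p : 'rV[R]_n * R => ((f (p.1 + p.2 *: d) - f p.1) / p.2)%:E)
            (filter_prod (nbhs x) (0 : R)^'+).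

Definition clarke_subdiff n (f : 'rV[R]_n -> R) (x : 'rV[R]_n) :
    set 'rV[R]_n :=
  [set v | forall d, ((dot v d)%:E <= clarke_dirderiv f x d)%E].

Definition inv_setmap n m (S : 'rV[R]_n -> set 'rV[R]_m) (y : 'rV[R]_m) :
    set 'rV[R]_n :=
  [set x | S x y].

Definition metrically_subregular n m (S : 'rV[R]_n -> set 'rV[R]_m)
    (xbar : 'rV[R]_n) (ybar : 'rV[R]_m) : Prop :=
  S xbar ybar /\
  exists kappa tau : R, [/\ 0 < kappa, 0 < tau &
    forall x, enorm (x - xbar) < tau ->
      (edist_set x (inv_setmap S ybar) <= kappa%:E * edist_set ybar (S x))%E].

Definition G_composite n m (h : 'rV[R]_m -> R) (c : 'rV[R]_n -> 'rV[R]_m)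
    (x : 'rV[R]_n) (eps : R) : set 'rV[R]_n :=
  [set mxvmul (grad c x) y | y in
    argmax (edom (convex_conj h)) (fun y =>
      (dot y (c x))%:E - convex_conj h y
      - (eps / 2 * enorm (mxvmul (grad c x) y) ^+ 2)%:E)%E].

End VariationalAnalysis.

Section Algorithm.
Context {R : realType} {n : nat}.
Variables (f : 'rV[R]_n -> R) (G : 'rV[R]_n -> R -> set 'rV[R]_n).
Variables (a : nat -> R) (theta_eps theta_nu alpha : R).

Record state := State {
  st_x : 'rV[R]_n;
  st_eps : R;
  st_nu : R;
  st_t : nat }.

Definition descent (x g : 'rV[R]_n) (eta : R) : Prop :=
  f (x - eta *: g) <= f x - alpha * eta * enorm g ^+ 2.

(* Given x^k and epsilon_{k,0} = eps0, the inner loop may draw the directions  *)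
(* g 0, ..., g i, stop exactly at index i and return the step size eta.        *)
(* Only the values of [g] up to i matter.                                      *)
Definition inner_loop (x : 'rV[R]_n) (eps0 : R) (g : nat -> 'rV[R]_n)
    (i : nat) (eta : R) : Prop :=
  let step j := eps0 / 2 ^+ j in
  [/\ forall l, (l <= i)%N -> G x (step l) (g l),
      forall l, (l < i)%N -> forall j, (j <= l)%N -> ~ descent x (g l) (step j) &
      exists j, [/\ (j <= i)%N,
        descent x (g i) (step j),
        forall j', (j' < j)%N -> ~ descent x (g i) (step j') &
        (exists2 l, (j <= l <= i)%N & eta = step l) /\
        forall l, (j <= l <= i)%N ->
          f (x - eta *: g i) <= f (x - step l *: g i)]].

Definition outer_step (s s' : state) : Prop :=
  exists (g : nat -> 'rV[R]_n) (i : nat) (eta : R),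
  [/\ inner_loop (st_x s) (st_eps s) g i eta,
      st_x s' = st_x s - eta *: g i &
      if enorm (g i) <= st_nu s then
        let epst := a (st_t s).+1 `^ 4^-1 in
        exists gt : 'rV[R]_n,
        [/\ G (st_x s) epst gt,
            st_t s' = (st_t s).+1,
            st_nu s' = theta_nu * st_nu s &
            st_eps s' =
              if st_eps s * epst * enorm gt
                 <= Num.sqrt (st_eps s / 2 ^+ i * enorm (g i))
              then st_eps s else theta_eps * st_eps s]
      else
        [/\ st_t s' = st_t s, st_nu s' = st_nu s & st_eps s' = st_eps s]].

Definition generated (x0 : 'rV[R]_n) (eps00 nu0 : R) (x : nat -> 'rV[R]_n) :
    Prop :=
  exists s : nat -> state,
  [/\ s 0 = State x0 eps00 nu0 0,
      forall k, outer_step (s k) (s k.+1) &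
      forall k, x k = st_x (s k)].

End Algorithm.

(* Main.v *)
Require Import Defs.
From mathcomp Require Import all_boot all_order all_algebra.
From mathcomp Require Import all_classical all_reals all_analysis.
From mathcomp Require Import ring lra.
Import Order.TTheory GRing.Theory Num.Theory.
Import numFieldNormedType.Exports.
Local Open Scope classical_set_scope.
Local Open Scope ring_scope.

(** Write [rho = L * beta]. Linearizing [c] inside [h] gives at each [x] a convex
  model [linmodel h c x] that differs from [f] by at most
  [rho / 2 * enorm (z - x) ^+ 2], and a direction [g] in [G x eps] is the one for
  which [x - eps *: g] is the proximal point of that model
  ([argmax_subgradient], [G_composite_prox_grad]). The method is thus a
  prox-linear descent method, and two facts drive its rate.

  A uniform error bound ([error_bound_compact]): a small residual [enorm g]
  forces a stationary point within distance [K * enorm g]. Since [g] need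
  not be a Clarke subgradient of [f] at an iterate, one passes to a proximal point of [f]
  near [x], which carries a subgradient of the order of [enorm g]
  ([prox_grad_near_stationary]); metric subregularity then applies there. The
  Clarke subdifferential enters only through its description, valid for the
  weakly convex [f], as the set of vectors that support [f] globally up to
  [rho / 2] times the squared distance ([clarke_subdiff_ge],
  [mem_clarke_subdiff]).

  Step sizes bounded away from zero ([generated_steps]): backtracking does not
  go below a fixed constant ([inner_loop_bounds]), and monotonicity along
  the proximal path makes the ratio test succeed as soon as [a] is small
  ([ratio_test_passes]), so the initial trial step is reduced finitely often.

  Every step therefore decreases [f] by a multiple of [enorm g ^+ 2], while
  comparing the proximal step with the nearby stationary point bounds the
  remaining gap by a multiple of the same quantity ([prox_grad_le_near]). The
  separation of critical values fixes the value the gap is measured from, the gap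
  contracts geometrically, and the steps are summable ([linear_rate]). *)

Set Implicit Arguments.
Unset Strict Implicit.
Unset Printing Implicit Defensive.

(** * The Euclidean norm *)

Section Euclidean.
Context {R : realType}.
Implicit Types n m : nat.

Lemma dotC n (u v : 'rV[R]_n) : dot u v = dot v u.
Proof. by apply: eq_bigr => i _; rewrite mulrC. Qed.

Lemma dotDl n (u v w : 'rV[R]_n) : dot (u + v) w = dot u w + dot v w.
Proof. by rewrite -big_split; apply: eq_bigr => i _; rewrite mxE mulrDl. Qed.

Lemma dotZl n a (u v : 'rV[R]_n) : dot (a *: u) v = a * dot u v.
Proof. by rewrite /dot mulr_sumr; apply: eq_bigr => i _; rewrite mxE mulrA. Qed.

Lemma dotNl n (u v : 'rV[R]_n) : dot (- u) v = - dot u v.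
Proof. by rewrite -scaleN1r dotZl mulN1r. Qed.

Lemma dotDr n (u v w : 'rV[R]_n) : dot w (u + v) = dot w u + dot w v.
Proof. by rewrite !(dotC w) dotDl. Qed.

Lemma dotZr n a (u v : 'rV[R]_n) : dot u (a *: v) = a * dot u v.
Proof. by rewrite !(dotC u) dotZl. Qed.

Lemma dotNr n (u v : 'rV[R]_n) : dot u (- v) = - dot u v.
Proof. by rewrite !(dotC u) dotNl. Qed.

Definition dotE := (dotDl, dotDr, dotNl, dotNr, dotZl, dotZr).

Lemma dot0l n (u : 'rV[R]_n) : dot 0 u = 0.
Proof. by rewrite -(scale0r 0) dotZl mul0r. Qed.

Lemma dotvv_ge0 n (u : 'rV[R]_n) : 0 <= dot u u.
Proof. by apply: sumr_ge0 => i _; rewrite -expr2 sqr_ge0. Qed.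

Lemma enorm_ge0 n (u : 'rV[R]_n) : 0 <= enorm u.
Proof. exact: sqrtr_ge0. Qed.

Lemma enorm_sqr n (u : 'rV[R]_n) : enorm u ^+ 2 = dot u u.
Proof. by rewrite sqr_sqrtr// dotvv_ge0. Qed.

Lemma enormZ n a (u : 'rV[R]_n) : enorm (a *: u) = `|a| * enorm u.
Proof.
by rewrite /enorm dotZl dotZr mulrA -expr2 sqrtrM ?sqr_ge0// sqrtr_sqr.
Qed.

Lemma enormN n (u : 'rV[R]_n) : enorm (- u) = enorm u.
Proof. by rewrite -scaleN1r enormZ normrN1 mul1r. Qed.

Lemma enormB n (u v : 'rV[R]_n) : enorm (u - v) = enorm (v - u).
Proof. by rewrite -opprB enormN. Qed.

Lemma enorm0 n : enorm (0 : 'rV[R]_n) = 0.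
Proof. by rewrite /enorm dot0l sqrtr0. Qed.

Lemma enorm_eq0 n (u : 'rV[R]_n) : enorm u = 0 -> u = 0.
Proof.
move=> u0; have /eqP : dot u u = 0 by rewrite -enorm_sqr u0 expr0n.
rewrite psumr_eq0 => [/allP uz|i _]; last by rewrite -expr2 sqr_ge0.
apply/rowP => i; rewrite mxE; apply/eqP.
by have := uz i (mem_index_enum i); rewrite mulf_eq0 orbb.
Qed.

Lemma cauchy_schwarz n (u v : 'rV[R]_n) : dot u v <= enorm u * enorm v.
Proof.
set a := enorm u; set b := enorm v.
have [b0|b0] := eqVneq b 0.
  by rewrite b0 mulr0 dotC (enorm_eq0 b0) dot0l.
have [a0|a0] := eqVneq a 0.
  by rewrite a0 mul0r (enorm_eq0 a0) dot0l.
have ap : 0 < a by rewrite lt_def a0 enorm_ge0.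
have bp : 0 < b by rewrite lt_def b0 enorm_ge0.
have := dotvv_ge0 (b *: u - a *: v).
rewrite !dotE (dotC v u) -!enorm_sqr -/a -/b => ge0.
rewrite -(ler_pM2l (mulr_gt0 ap bp)).
nra.
Qed.

Lemma enormD n (u v : 'rV[R]_n) : enorm (u + v) <= enorm u + enorm v.
Proof.
rewrite -(ler_pXn2r (ltn0Sn 1)) ?nnegrE ?addr_ge0 ?enorm_ge0//.
rewrite sqrrD !enorm_sqr !dotE (dotC v u).
by have := cauchy_schwarz u v; lra.
Qed.

Lemma enorm_trans n (w u v : 'rV[R]_n) :
  enorm (u - v) <= enorm (u - w) + enorm (w - v).
Proof. by rewrite -[u - v](subrKA w) enormD. Qed.

Lemma enorm_continuous n (x : 'rV[R]_n) :
  continuous (fun z : 'rV[R]_n => enorm (z - x)).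
Proof.
have c i : continuous (fun w : 'rV[R]_n => (w - x) 0 i).
  have -> : (fun w : 'rV[R]_n => (w - x) 0 i) = (fun w => w 0 i) - cst (x 0 i).
    by apply/funext => w; rewrite !mxE.
  move=> z.
  by apply: continuousB; [exact: coord_continuous | exact: cst_continuous].
have cs : continuous (fun w : 'rV[R]_n => dot (w - x) (w - x)).
  apply: continuous_big => [|i _ w]; first exact: add_continuous.
  by apply: continuousM; exact: c.
by move=> z; apply: (continuous_comp (cs z)); exact: sqrt_continuous.
Qed.

Lemma norm_le_enorm n (u : 'rV[R]_n) : `|u| <= enorm u.
Proof.
rewrite [leLHS]/Num.norm /= mx_normrE; apply/bigmax_leP; split=> [|[i j] _ /=].
  exact: enorm_ge0.
rewrite (ord1 i) -sqrtr_sqr ler_sqrt ?dotvv_ge0// /dot (bigD1 j)//= expr2.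
by rewrite lerDl sumr_ge0// => k _; rewrite -expr2 sqr_ge0.
Qed.

Lemma near_enorm n (x : 'rV[R]_n) (e : R) : 0 < e ->
  \forall z \near x, enorm (z - x) < e.
Proof.
move=> e0; have := @enorm_continuous n x x.
move=> /(_ [set r | r < e]); apply.
rewrite /= subrr enorm0; by apply: open_nbhs_nbhs; split.
Qed.

Lemma enorm_lip_continuous n (F : 'rV[R]_n -> R) L :
  (forall u v, `|F u - F v| <= L * enorm (u - v)) -> continuous F.
Proof.
move=> lipF x; apply/(@cvgrPdist_lt _ _ _ (nbhs x)) => e e0.
have L1 : 0 < `|L| + 1 by rewrite ltr_wpDl.
near=> z; rewrite (le_lt_trans (lipF _ _))//.
rewrite (@le_lt_trans _ _ ((`|L| + 1) * enorm (z - x)))//.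
  rewrite enormB ler_wpM2r ?enorm_ge0// (le_trans (ler_norm L))//.
  by rewrite lerDl.
rewrite mulrC -ltr_pdivlMr//; near: z.
by apply: near_enorm; rewrite divr_gt0.
Unshelve. all: end_near. Qed.

(** The quadratic penalty confines the search for a minimizer to a ball, whose
  compactness yields one. *)
Lemma prox_exists n (F : 'rV[R]_n -> R) (b A : R) (x : 'rV[R]_n) :
  continuous F -> (forall z, b <= F z) -> 0 < A ->
  exists p, forall z,
    F p + A * dot (p - x) (p - x) <= F z + A * dot (z - x) (z - x).
Proof.
move=> cF Fb A0.
pose Q z := F z + A * enorm (z - x) ^+ 2.
have cQ : continuous Q.
  move=> z; pose N (w : 'rV[R]_n) := A * enorm (w - x) ^+ 2.
  apply: (@continuousD _ _ _ F N z (cF z)).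
  apply: continuousM; first exact: cst_continuous.
  by apply: continuousM; exact: enorm_continuous.
pose S := [set z | Q z <= Q x].
have Sx : S x by exact: lexx.
have cS : compact S.
  apply: bounded_closed_compact; last first.
    by apply: (@closed_comp _ _ Q [set r | r <= Q x]) => [z _|];
      [exact: cQ | exact: closed_le].
  exists (1 + (F x - b) / A + enorm x); split; first by rewrite num_real.
  move=> M Mlt z; rewrite /S /= /Q subrr enorm0 expr0n mulr0 addr0 => zS.
  apply/(le_trans (norm_le_enorm z))/(le_trans _ (ltW Mlt)).
  have /le_trans-> // : enorm z <= enorm (z - x) + enorm x.
    by rewrite -{1}[z](subrK x) enormD.
  rewrite lerD2r.
  have D : enorm (z - x) ^+ 2 <= (F x - b) / A.
    by rewrite ler_pdivlMr// mulrC; have := Fb z; lra.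
  by have := sqr_ge0 (enorm (z - x) - 1); have := enorm_ge0 (z - x); nra.
have [p pS pmin] := EVT_min_rV (ex_intro _ _ Sx) cS (continuous_subspaceT cQ).
exists p => z; rewrite -!enorm_sqr -!/(Q _).
have [zS|] := leP (Q z) (Q x); first by apply: pmin; rewrite inE.
by move=> /ltW; apply: le_trans; move: pS; rewrite inE.
Qed.

Lemma dot_mulmx n m (A : 'M[R]_(n, m)) (d : 'rV[R]_n) (y : 'rV[R]_m) :
  dot (d *m A) y = dot d (mxvmul A y).
Proof.
transitivity ((d *m A *m y^T) 0 0).
  by rewrite [RHS]mxE; apply: eq_bigr => i _; rewrite [_^T _ _]mxE.
transitivity ((d *m (mxvmul A y)^T) 0 0).
  by rewrite /mxvmul trmx_mul trmxK mulmxA.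
by rewrite [LHS]mxE; apply: eq_bigr => i _; rewrite [_^T _ _]mxE.
Qed.

Lemma enorm_mxvmul n m (A : 'M[R]_(n, m)) (y : 'rV[R]_m) :
  enorm (mxvmul A y) <= opnorm A * enorm y.
Proof.
(* The Frobenius norm bounds the set that defines [opnorm], so its
   supremum is a least upper bound and not the default value. *)
have ub : has_ubound [set enorm (mxvmul A z) | z in [set z | enorm z <= 1]].
  exists (Num.sqrt (\sum_i enorm (row i A) ^+ 2)) => _ [z /= z1 <-].
  apply: ler_wsqrtr; apply: ler_sum => i _.
  have -> : mxvmul A z 0 i = dot z (row i A).
    by rewrite mxE; apply: eq_bigr => j _; rewrite !mxE.
  have zi w : enorm w = enorm (row i A) -> dot z w <= enorm (row i A).
    move=> wA; rewrite (le_trans (cauchy_schwarz _ _))// wA.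
    by rewrite ler_piMl ?enorm_ge0.
  rewrite -expr2 -[X in X <= _]real_normK ?num_real//.
  rewrite ler_pXn2r ?nnegrE ?enorm_ge0// ler_norml lerNl -dotNr.
  by rewrite !zi// enormN.
have [/enorm_eq0->|y0] := eqVneq (enorm y) 0.
  by rewrite /mxvmul mul0mx !enorm0 mulr0.
have yp : 0 < enorm y by rewrite lt_def y0 enorm_ge0.
rewrite -ler_pdivrMr// -[X in _ / X]ger0_norm ?enorm_ge0//.
rewrite mulrC -normfV -enormZ /mxvmul scalemxAl.
apply: ub_le_sup => //; exists ((enorm y)^-1 *: y) => //=.
by rewrite enormZ ger0_norm ?invr_ge0 ?enorm_ge0// mulVf.
Qed.

Lemma mulmx_enorm_le n m (A : 'M[R]_(n, m)) (d : 'rV[R]_n) (y : 'rV[R]_m) :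
  dot (d *m A) y <= opnorm A * enorm d * enorm y.
Proof.
rewrite dot_mulmx (le_trans (cauchy_schwarz _ _))// mulrAC mulrC.
by rewrite ler_wpM2r ?enorm_ge0// enorm_mxvmul.
Qed.

End Euclidean.

(** * Convex functions, proximal points and the conjugate *)

Section ConvexAnalysis.
Context {R : realType}.

Lemma le_of_le_add_small (a b k : R) :
  (forall t, 0 < t <= 1 -> a <= b + t * k) -> a <= b.
Proof.
move=> H; rewrite leNgt; apply/negP => ba.
have d0 : 0 < 2 * (`|k| + (a - b)) by have := normr_ge0 k; lra.
have := H ((a - b) / (2 * (`|k| + (a - b)))).
rewrite divr_gt0 ?subr_gt0//= ler_pdivrMr// => /(_ _)/wrap[].
  by have := normr_ge0 k; lra.
rewrite mulrAC -lerBlDl ler_pdivlMr// => le.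
by have := ler_norm k; have := normr_ge0 k; nra.
Qed.

Definition subgradient n (h : 'rV[R]_n -> R) (u y : 'rV[R]_n) : Prop :=
  forall w, h u + dot y (w - u) <= h w.

Lemma convex_functionE n (h : 'rV[R]_n -> R) :
  convex_function [set: 'rV[R]_n] h ->
  forall t u v, 0 <= t <= 1 ->
    h (u + t *: (v - u)) <= (1 - t) * h u + t * h v.
Proof.
move=> hconv t u v t01.
have /andP[t0 t1] := t01.
have := hconv (Itv01 t0 t1) v u (mem_set I) (mem_set I).
rewrite convRE /= /conv /= addrC => le.
rewrite (_ : u + t *: (v - u) = (1 - t) *: u + t *: v); last first.
  by rewrite scalerBr scalerBl scale1r addrCA addrC.
by rewrite (le_trans le)// addrC.
Qed.

(** The subgradient inequality is tested one step along the subgradient. *)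
Lemma subgradient_lip n (h : 'rV[R]_n -> R) L u y : 0 <= L ->
  (forall u v, `|h u - h v| <= L * enorm (u - v)) ->
  subgradient h u y -> enorm y <= L.
Proof.
move=> L0 hlip /(_ (u + y)); have := hlip (u + y) u.
rewrite addrAC subrr add0r -enorm_sqr => lip sub.
have := ler_norm (h (u + y) - h u); have := enorm_ge0 y; nra.
Qed.

(** The minimality of [p] along the segment from [p] to [z] has a penalty term
  whose second-order part vanishes with the step. *)
Lemma prox_subgradient n (h : 'rV[R]_n -> R) (A : R) (u p : 'rV[R]_n) :
  convex_function [set: 'rV[R]_n] h ->
  (forall z, h p + A * dot (p - u) (p - u) <= h z + A * dot (z - u) (z - u)) ->
  subgradient h p ((2 * A) *: (u - p)).
Proof.
move=> hconv pmin z.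
apply: (@le_of_le_add_small _ _ (A * dot (z - p) (z - p))) => t /andP[t0 t1].
have hc : h (p + t *: (z - p)) <= (1 - t) * h p + t * h z.
  by apply: convex_functionE => //; rewrite ltW.
have := pmin (p + t *: (z - p)); move: hc.
set a := u - p; set b := z - p.
have -> : p - u = - a by rewrite opprB.
have -> : p + t *: b - u = t *: b - a by rewrite addrAC addrC opprB.
clearbody a b; rewrite !dotE (dotC b a) => {}hc le.
by rewrite -(ler_pM2l t0); lra.
Qed.

Lemma convex_conj_le n (h : 'rV[R]_n -> R) y b :
  (forall w, dot y w - h w <= b) -> (convex_conj h y <= b%:E)%E.
Proof. by move=> le; apply: ub_ereal_sup => _ [w _ <-]; rewrite lee_fin. Qed.

Lemma edomP n (h : 'rV[R]_n -> R) y : edom (convex_conj h) y ->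
  exists2 b, convex_conj h y = b%:E & forall w, dot y w - h w <= b.
Proof.
rewrite /edom /= => ydom.
have ub w : ((dot y w - h w)%:E <= convex_conj h y)%E.
  by apply: ereal_sup_ubound; exists w.
have fy : convex_conj h y \is a fin_num.
  by rewrite fin_numElt ydom andbT (lt_le_trans _ (ub 0))// ltNyr.
by exists (fine (convex_conj h y)) => [|w]; rewrite ?fineK// -lee_fin fineK.
Qed.

(** The maximizer solves a concave problem over a convex set, so its first-order
  condition says that it also maximizes [dot z u - convex_conj h z], where [u]
  is the argument of the subgradient below. What remains is that this maximum is
  at least [h u], a half of the Fenchel-Moreau identity: the subgradients of [h]
  at its proximal points near [u] give affine minorants whose values at [u] come
  arbitrarily close to [h u]. *)
Lemma argmax_subgradient n m (h : 'rV[R]_m -> R) (L b eps : R)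
    (A : 'M[R]_(n, m)) (u0 y : 'rV[R]_m) :
  convex_function [set: 'rV[R]_m] h -> 0 <= L ->
  (forall u v, `|h u - h v| <= L * enorm (u - v)) ->
  (forall z, b <= h z) ->
  argmax (edom (convex_conj h)) (fun y =>
      (dot y u0)%:E - convex_conj h y
      - (eps / 2 * enorm (mxvmul A y) ^+ 2)%:E)%E y ->
  subgradient h (u0 - eps *: (mxvmul A y *m A)) y.
Proof.
move=> hconv L0 hlip hb [/edomP[cy cyE yub] ymax].
set u := u0 - _.
have first_order z cz : (forall w, dot z w - h w <= cz) ->
    dot z u - cz <= dot y u - cy.
  move=> zub.
  pose g := mxvmul A y; pose d := mxvmul A (z - y).
  apply: (@le_of_le_add_small _ _ (eps / 2 * dot d d)) => t /andP[t0 t1].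
  pose yt := y + t *: (z - y).
  have ytub w : dot yt w - h w <= (1 - t) * cy + t * cz.
    have := yub w; have := zub w; rewrite !dotE => ? ?; nra.
  have ytle := convex_conj_le ytub.
  have /edomP[ct ctE _] : edom (convex_conj h) yt.
    by rewrite /edom /= (le_lt_trans ytle)// ltry.
  have := ymax yt; rewrite /edom /= ctE ltry => /(_ isT).
  rewrite cyE -!EFinB lee_fin.
  rewrite ctE lee_fin in ytle.
  have -> : mxvmul A yt = g + t *: d.
    by rewrite /mxvmul mulmxDl -scalemxAl.
  have -> : dot yt u0 = dot y u0 + t * (dot z u0 - dot y u0) by rewrite !dotE.
  have uE w : dot w u = dot w u0 - eps * dot g (mxvmul A w).
    by rewrite -dot_mulmx (dotC _ w) /u !dotE.
  have zE : mxvmul A z = g + d by rewrite /g /d /mxvmul -mulmxDl addrC subrK.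
  rewrite !uE zE !enorm_sqr -/g; clearbody g d; rewrite !dotE (dotC d g) => le.
  by rewrite -(ler_pM2l t0); lra.
have key : h u <= dot y u - cy.
  apply: (@le_of_le_add_small _ _ (L ^+ 2 / 2)) => t /andP[t0 t1].
  have V0 : 0 < t^-1 by rewrite invr_gt0.
  have [p pmin] := prox_exists u (enorm_lip_continuous hlip) hb V0.
  have := prox_subgradient hconv pmin; set z := _ *: _ => zsub.
  have zL := subgradient_lip L0 hlip zsub.
  have zub w : dot z w - h w <= dot z p - h p.
    by have := zsub w; rewrite !dotE; lra.
  have := first_order _ _ zub.
  have upE : u - p = (t / 2) *: z.
    by rewrite /z scalerA (_ : t / 2 * _ = 1) ?scale1r//; field; rewrite gt_eqF.
  have : `|h u - h p| <= L * enorm (u - p) := hlip _ _.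
  have -> : dot z u = dot z p + t / 2 * dot z z.
    by rewrite -dotZr -upE -dotDr addrC subrK.
  have t2 : 0 <= t / 2 by lra.
  rewrite upE enormZ (ger0_norm t2) -enorm_sqr.
  have := ler_norm (h u - h p).
  have := mulr_ge0 t2 (sqr_ge0 (enorm z)).
  have : 0 <= t / 2 * (L * (L - enorm z)).
    by apply/(mulr_ge0 t2)/mulr_ge0 => //; rewrite subr_ge0.
  lra.
by clearbody u => w; have := yub w; rewrite dotDr dotNr; lra.
Qed.

End ConvexAnalysis.

(** * Taylor estimate for the inner map *)

Section CompositeModel.
Context {R : realType}.

Lemma is_derive_along n m (c : 'rV[R]_n -> 'rV[R]_m) (x d : 'rV[R]_n)
    (e : 'rV[R]_m) (t : R) : differentiable c (x + t *: d) ->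
  is_derive t 1 (fun s => dot e (c (x + s *: d)))
    (dot e (d *m grad c (x + t *: d))).
Proof.
move=> cdiff; set a := x + t *: d.
have cv : h^-1 *: (c (h *: d + a) - c a) @[h --> 0^'] --> 'D_d c a.
  exact: diff_derivable.
have dot_cont : continuous (dot e).
  apply: (@enorm_lip_continuous _ _ _ (enorm e)) => u v.
  rewrite -dotNr -dotDr ler_norml cauchy_schwarz andbT lerNl -dotNr.
  by rewrite -[enorm (u - v)]enormN cauchy_schwarz.
have cv' : h^-1 *: (dot e (c (x + (h *: 1 + t) *: d)) - dot e (c a)) @[h --> 0^']
    --> dot e (d *m grad c a).
  rewrite /grad -deriveEjacobian//.
  apply: cvg_trans (cvg_comp _ _ cv (dot_cont _)).
  rewrite (_ : (fun h => _) = dot e \o (fun h => h^-1 *: (c (h *: d + a) - c a)))//.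
  apply/funext => h /=; rewrite dotZr dotDr dotNr.
  by rewrite (_ : h *: (1 : R) = h) ?scalerDl 1?addrCA //; exact: mulr1.
apply: DeriveDef; first by apply/cvg_ex; eexists; exact: cv'.
exact: cvg_lim cv'.
Qed.

Lemma quadratic_growth (phi dphi : R -> R) (a k : R) :
  (forall t : R, is_derive t (1 : R) phi (dphi t)) ->
  (forall t, 0 < t < 1 -> dphi t <= a + k * t) ->
  phi 1 <= phi 0 + a + k / 2.
Proof.
move=> dphiE dle.
pose psi := phi - ((a \*: id) + (k / 2) \*: (id ^+ 2)).
have dpsi (t : R) : is_derive t (1 : R) psi (dphi t - (a + k * t)).
  apply: is_derive_eq; rewrite /GRing.scale /= mulr1 expr1.
  by congr (_ - (_ + _)); rewrite -[2%:R]/2; field.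
have [|t] := @MVT R psi (fun t => dphi t - (a + k * t)) 0 1 ltr01 (fun t _ => dpsi t).
  by apply: derivable_within_continuous => t _; exact: ex_derive.
rewrite in_itv /= => /dle le; rewrite subr0 mulr1 => E.
have : psi 1 - psi 0 <= 0 by rewrite E subr_le0.
have psiE s : psi s = phi s - (a * s + k / 2 * s ^+ 2) by [].
by rewrite !psiE; lra.
Qed.

(** The remainder is tested against itself, which reduces the estimate to a real
  function on the segment. *)
Lemma taylor_quadratic n m (c : 'rV[R]_n -> 'rV[R]_m) (beta : R) :
  0 <= beta -> (forall x, differentiable c x) ->
  (forall u v, opnorm (grad c u - grad c v) <= beta * enorm (u - v)) ->
  forall x z, enorm (c z - (c x + (z - x) *m grad c x))
    <= beta / 2 * dot (z - x) (z - x).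
Proof.
move=> beta0 cdiff clip x z; set d := z - x; set e := c z - _.
have xd : x + 1 *: d = z by rewrite scale1r /d addrC subrK.
have le : enorm e ^+ 2 <= enorm e * (beta / 2 * dot d d).
  have D t := is_derive_along e (cdiff (x + t *: d)).
  have := @quadratic_growth _ _ (dot e (d *m grad c x))
    (beta * dot d d * enorm e) D.
  rewrite /= scale0r addr0 xd => /(_ _)/wrap[t /andP[t0 _]|].
    rewrite -lerBlDl -dotNr -dotDr -mulmxBr dotC.
    apply: (le_trans (mulmx_enorm_le _ _ _)); rewrite [leRHS]mulrAC.
    rewrite ler_wpM2r ?enorm_ge0//.
    apply: (le_trans (ler_wpM2r (enorm_ge0 _) (clip _ _))).
    rewrite addrAC subrr add0r enormZ gtr0_norm// -enorm_sqr.
    by rewrite le_eqVlt; apply/orP; left; apply/eqP; ring.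
  have -> : c z = e + (c x + d *m grad c x) by rewrite subrK.
  by clearbody e d; rewrite !dotDr enorm_sqr; lra.
have := enorm_ge0 e; rewrite le_eqVlt => /predU1P[<-|e0].
  by rewrite mulr_ge0 ?divr_ge0 ?dotvv_ge0.
by rewrite -(ler_pM2l e0) -expr2.
Qed.

End CompositeModel.

(** * Weak convexity, Clarke subgradients and prox-linear steps *)

Section WeakConvexity.
Context {R : realType}.

Definition linmodel n m (h : 'rV[R]_m -> R) (c : 'rV[R]_n -> 'rV[R]_m)
    (x z : 'rV[R]_n) : R :=
  h (c x + (z - x) *m grad c x).

Lemma linmodel_error n m (h : 'rV[R]_m -> R) (c : 'rV[R]_n -> 'rV[R]_m)
    (L beta : R) :
  0 <= L -> (forall u v, `|h u - h v| <= L * enorm (u - v)) ->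
  0 <= beta -> (forall x, differentiable c x) ->
  (forall u v, opnorm (grad c u - grad c v) <= beta * enorm (u - v)) ->
  forall x z, `|linmodel h c x z - h (c z)|
    <= L * beta / 2 * dot (z - x) (z - x).
Proof.
move=> L0 hlip beta0 cdiff clip x z; rewrite distrC (le_trans (hlip _ _))//.
by rewrite -!mulrA ler_wpM2l// mulrA taylor_quadratic.
Qed.

Lemma linmodel_convex n m (h : 'rV[R]_m -> R) (c : 'rV[R]_n -> 'rV[R]_m) :
  convex_function [set: 'rV[R]_m] h ->
  forall x p d t, 0 <= t <= 1 ->
    linmodel h c x (p + t *: d)
      <= (1 - t) * linmodel h c x p + t * linmodel h c x (p + d).
Proof.
move=> hconv x p d t t01; rewrite /linmodel.
apply: le_trans (convex_functionE hconv _ _ t01); rewrite le_eqVlt.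
apply/orP; left; apply/eqP; congr h.
rewrite opprD addrACA subrr add0r -mulmxBl opprB addrA subrK [p + d]addrC addrK.
by rewrite scalemxAl -[RHS]addrA -mulmxDl [p + _ - x]addrAC.
Qed.

Definition weakly_convex n (rho : R) (f : 'rV[R]_n -> R) : Prop :=
  forall p d t, 0 <= t <= 1 ->
    f (p + t *: d)
      <= (1 - t) * f p + t * f (p + d) + rho / 2 * (t * (1 - t)) * dot d d.

(** Linearizing at the intermediate point turns convexity of the model into
  convexity of [f] up to the error of the model at both ends of the segment. *)
Lemma weakly_convex_of_model n (f : 'rV[R]_n -> R)
    (phi : 'rV[R]_n -> 'rV[R]_n -> R) rho :
  (forall x z, `|phi x z - f z| <= rho / 2 * dot (z - x) (z - x)) ->
  (forall x p d t, 0 <= t <= 1 ->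
    phi x (p + t *: d) <= (1 - t) * phi x p + t * phi x (p + d)) ->
  weakly_convex rho f.
Proof.
move=> err conv p d t /[dup] t01 /andP[t0 t1].
set w := p + t *: d.
have fw : f w <= phi w w.
  have := err w w; rewrite subrr dot0l mulr0 => /(le_trans (ler_norm _)).
  have := err w w; rewrite subrr dot0l mulr0 normr_le0 subr_eq0 => /eqP->.
  by rewrite lexx.
have ep := err w p; have ed := err w (p + d).
have pw : p - w = - t *: d by rewrite /w opprD addrA subrr add0r scaleNr.
have dw : p + d - w = (1 - t) *: d.
  by rewrite /w opprD addrACA subrr add0r scalerBl scale1r.
rewrite pw !dotZl !dotZr in ep; rewrite dw !dotZl !dotZr in ed.
have {}ep := le_trans (ler_norm _) ep; have {}ed := le_trans (ler_norm _) ed.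
have := conv w p d t t01; rewrite -/w => cw.
have t1' : 0 <= 1 - t by rewrite subr_ge0.
have := ler_wpM2l t0 ed; have := ler_wpM2l t1' ep; clearbody w.
lra.
Qed.

(** Weak convexity bounds all difference quotients with step at most 1 by the
  increment of [f] over the full step, so a Clarke subgradient supports [f]
  globally up to a quadratic term. *)
Lemma clarke_subdiff_ge n (f : 'rV[R]_n -> R) rho x v :
  0 <= rho -> continuous f -> weakly_convex rho f -> clarke_subdiff f x v ->
  forall z, f x + dot v (z - x) - rho / 2 * dot (z - x) (z - x) <= f z.
Proof.
move=> rho0 cf wf vx z; set d := z - x.
have xd : x + d = z by rewrite addrC subrK.
rewrite leNgt; apply/negP => lt.
pose e := (f x + dot v d - rho / 2 * dot d d - f z) / 3.
have e0 : 0 < e by rewrite /e; lra.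
have := vx d; rewrite leNgt => /negP; apply.
pose A := [set p | `|f x - f p| < e /\ `|f z - f (p + d)| < e].
pose B := [set t : R | 0 < t <= 1].
have Ax : nbhs x A.
  have c1 : {for x, continuous (fun p : 'rV[R]_n => f (p + d))}.
    have cd := @continuousD _ _ _ id (cst d) x (@cvg_id _ _) (@cst_continuous _ _ _ _).
    exact: (continuous_comp cd (cf _)).
  have n1 : nbhs x (fun p : 'rV[R]_n => `|f x - f p| < e).
    exact: (@cvgr_dist_lt _ _ _ (nbhs x) _ _ _ (cf x) e e0).
  have : nbhs x (fun p : 'rV[R]_n => `|f z - f (p + d)| < e).
    by rewrite -xd; exact: (@cvgr_dist_lt _ _ _ (nbhs x) _ _ _ c1 e e0).
  by move=> n2; exact: (filterI n1 n2).
have B0 : (0 : R)^'+ B.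
  near=> t; rewrite /B /=; apply/andP; split; near: t.
    exact: nbhs_right_gt.
  by apply: nbhs_right_le; exact: ltr01.
apply: (@le_lt_trans _ _ ((dot v d - e)%:E)); last first.
  by rewrite lte_fin gtrDl oppr_lt0.
apply: (@le_trans _ _ (ereal_sup [set
    ((f (p.1 + p.2 *: d) - f p.1) / p.2)%:E | p in A `*` B])).
  by apply: ereal_inf_lbound; exists (A `*` B) => //; exists (A, B).
apply: ub_ereal_sup => _ [[p t] [/= [px pz] /andP[t0 t1]] <-].
rewrite lee_fin ler_pdivrMr//.
have := wf p d t; rewrite (ltW t0) t1 => /(_ isT) wp.
rewrite ltr_norml in px; rewrite ltr_norml in pz.
have /andP[px1 px2] := px; have /andP[pz1 pz2] := pz.
have : 0 <= rho / 2 * t ^+ 2 * dot d d.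
  by rewrite mulr_ge0 ?dotvv_ge0// mulr_ge0 ?sqr_ge0// divr_ge0.
have : f (p + d) - f p + rho / 2 * dot d d <= dot v d - e.
  have : e * 3 = f x + dot v d - rho / 2 * dot d d - f z by rewrite divfK.
  clearbody e; lra.
rewrite -(ler_pM2r t0); lra.
Unshelve. all: end_near. Qed.

(** Every neighborhood in the upper limit contains [x] itself, and the difference
  quotients based at [x] already exceed [dot v d] up to a term of the order of
  the step. *)
Lemma mem_clarke_subdiff n (f : 'rV[R]_n -> R) K x v :
  (forall z, f x + dot v (z - x) - K * dot (z - x) (z - x) <= f z) ->
  clarke_subdiff f x v.
Proof.
move=> supp d; apply: le_ereal_inf_tmp => _ [V [[A B] [/= Ax B0] ABV] <-].
apply/lee_addgt0Pr => e e0.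
have [t [Bt t0 te]] : exists t : R, [/\ B t, 0 < t & t * (`|K * dot d d| + 1) < e].
  near (0 : R)^'+ => t; exists t; split; near: t.
  - exact: B0.
  - exact: nbhs_right_gt.
  - near=> t; rewrite -ltr_pdivlMr ?ltr_wpDl//; near: t.
    by apply: nbhs_right_lt; rewrite divr_gt0// ltr_wpDl.
have : (((f (x + t *: d) - f x) / t)%:E <= ereal_sup [set
    ((f (p.1 + p.2 *: d) - f p.1) / p.2)%:E | p in V])%E.
  apply: ereal_sup_ubound; exists (x, t) => //; apply: ABV; split => //=.
  exact: nbhs_singleton.
move=> /(leeD2r e%:E); apply: le_trans; rewrite -EFinD lee_fin.
rewrite -lerBlDr ler_pdivlMr//.
have := supp (x + t *: d).
have -> : x + t *: d - x = t *: d by rewrite addrAC subrr add0r.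
rewrite !dotE.
have := ler_norm (K * dot d d); nra.
Unshelve. all: end_near. Qed.

End WeakConvexity.

Section ProxLinearStep.
Context {R : realType} {n : nat}.
Implicit Types (phi f : 'rV[R]_n -> R) (x z g : 'rV[R]_n).

(** For convex [phi] this is the optimality condition that makes [x - eps *: g]
  the proximal point of [phi] at [x] with parameter [eps]. *)
Definition prox_grad phi x eps g := subgradient phi (x - eps *: g) g.

(** Adding the subgradient inequalities at the two proximal points gives
  [(enorm g1 - enorm g2) * (e1 * enorm g1 - e2 * enorm g2) <= 0], and for
  [e1 <= e2] only one sign pattern of the factors is possible. *)
Lemma prox_grad_monotone phi x e1 e2 g1 g2 : 0 < e1 -> e1 <= e2 ->
  prox_grad phi x e1 g1 -> prox_grad phi x e2 g2 ->
  enorm g2 <= enorm g1 /\ e1 * enorm g1 <= e2 * enorm g2.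
Proof.
move=> e10 e12 s1 s2.
have := s1 (x - e2 *: g2); have := s2 (x - e1 *: g1).
have diffE a b : x - a - (x - b) = b - a :> 'rV[R]_n.
  by rewrite opprB addrC addrA subrK.
rewrite !diffE !dotE (dotC g2 g1) -!enorm_sqr => le2 le1.
have := cauchy_schwarz g1 g2; have := enorm_ge0 g1; have := enorm_ge0 g2.
set a := enorm g1 in le1 le2 *; set b := enorm g2 in le1 le2 *.
move=> b0 a0 cs.
have prod : (a - b) * (e1 * a - e2 * b) <= 0 by nra.
split; rewrite leNgt; apply/negP => lt.
  have : e1 * a < e2 * b by nra.
  nra.
have : b < a by nra.
nra.
Qed.

Context {rho b : R} {f phi : 'rV[R]_n -> R} {x : 'rV[R]_n}.
Hypothesis rho0 : 0 <= rho.
Hypothesis model_error :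
  forall z, `|phi z - f z| <= rho / 2 * dot (z - x) (z - x).
Context {eps : R} {g : 'rV[R]_n}.
Hypothesis eps0 : 0 < eps.
Hypothesis gP : prox_grad phi x eps g.

Lemma prox_grad_le z : f (x - eps *: g) <= f z
  + rho / 2 * dot (z - x) (z - x) - dot g (z - x)
  - eps * (1 - rho / 2 * eps) * dot g g.
Proof.
have := gP z; have := model_error z; have := model_error (x - eps *: g).
have -> : x - eps *: g - x = - (eps *: g) by rewrite addrAC subrr add0r.
have -> : z - (x - eps *: g) = (z - x) + eps *: g.
  by rewrite opprB addrCA addrC.
rewrite !ler_norml => /andP[l1 l2] /andP[l3 l4].
move: l1 l2 l3 l4; set xp := x - _; set d := z - x; clearbody xp d.
by rewrite !dotE; lra.
Qed.

Lemma prox_grad_decrease : f (x - eps *: g)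
  <= f x - eps * (1 - rho / 2 * eps) * enorm g ^+ 2.
Proof.
by have := prox_grad_le x; rewrite subrr (dotC g) !dot0l enorm_sqr; lra.
Qed.

Lemma prox_grad_le_near z K : enorm (z - x) <= K * enorm g ->
  f (x - eps *: g)
    <= f z + (rho / 2 * K ^+ 2 + K + rho / 2 * eps ^+ 2) * enorm g ^+ 2.
Proof.
move=> zx; have := prox_grad_le z.
have := cauchy_schwarz (- g) (z - x); rewrite dotNl enormN -!enorm_sqr.
have sq : enorm (z - x) ^+ 2 <= (K * enorm g) ^+ 2.
  by rewrite ler_pXn2r ?nnegrE ?enorm_ge0// (le_trans (enorm_ge0 _) zx).
have := ler_wpM2l (enorm_ge0 g) zx.
have := ler_wpM2l (_ : 0 <= rho / 2) sq; rewrite divr_ge0// => /(_ isT).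
have := mulr_ge0 (ltW eps0) (sqr_ge0 (enorm g)); lra.
Qed.

(** The subgradient comes from a proximal point [y] of [f] itself, taken with a
  penalty weight that exceeds the model error. The minimality of [y] against the
  step [x - eps *: g], whose value the model bounds in turn by the one at [y],
  leaves a quadratic inequality between [enorm (y - x)] and [enorm g]. *)
Lemma prox_grad_near_stationary E : continuous f -> (forall z, b <= f z) ->
  eps <= E ->
  exists y v, [/\ clarke_subdiff f y v,
    enorm (y - x) <= (1 + (rho + 1) * E) * enorm g &
    enorm v <= (rho + 2) * (1 + (rho + 1) * E) * enorm g].
Proof.
move=> cf fb epsE; have r0 := rho0.
(* This weight exceeds the model error [rho / 2] by one, so comparing [y] with the
   step leaves the term [enorm (y - x) ^+ 2] on the left. *)
have A0 : 0 < (rho + 2) / 2 by lra.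
have [y ymin] := prox_exists x cf fb A0.
exists y, ((rho + 2) *: (x - y)).
have yx : enorm (y - x) <= (1 + (rho + 1) * E) * enorm g.
  have := ymin (x - eps *: g); have := prox_grad_le y.
  rewrite [x - _ - x]addrAC subrr add0r.
  have := cauchy_schwarz (- g) (y - x); rewrite dotNl enormN.
  move: (y - x) => s; rewrite !dotE -!enorm_sqr => cs le1 le2.
  have key : enorm s ^+ 2
      <= enorm g * enorm s + (rho + 1) * E ^+ 2 * enorm g ^+ 2.
    have : (rho + 1) * eps ^+ 2 * enorm g ^+ 2
        <= (rho + 1) * E ^+ 2 * enorm g ^+ 2.
      rewrite ler_wpM2r ?sqr_ge0// ler_wpM2l ?addr_ge0//.
      by rewrite ler_pXn2r ?nnegrE// ltW// (lt_le_trans eps0).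
    have := mulr_ge0 (ltW eps0) (sqr_ge0 (enorm g)); lra.
  have E0 : 0 < E by apply: lt_le_trans epsE.
  have := enorm_ge0 g; have := enorm_ge0 s; move: key.
  move: (enorm s) (enorm g) => S G key S0 G0.
  rewrite leNgt; apply/negP => lt.
  have SG : 0 <= (1 + (rho + 1) * E) * G.
    by rewrite mulr_ge0// addr_ge0// mulr_ge0 ?addr_ge0// ltW.
  have S1 : 0 < S by apply: le_lt_trans lt.
  have k0 : 0 <= (rho + 1) * E by rewrite mulr_ge0 ?addr_ge0// ltW.
  have h1 : S * ((1 + (rho + 1) * E) * G) < S * S by rewrite ltr_pM2l.
  have h2 := ler_wpM2l (mulr_ge0 k0 G0) (ltW lt).
  have h3 : 0 <= (rho + 1) * rho * E ^+ 2 * G ^+ 2.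
    do 2![apply: mulr_ge0 (sqr_ge0 _)].
    by apply: mulr_ge0 => //; rewrite addr_ge0.
  have h4 := mulr_ge0 k0 (sqr_ge0 G).
  lra.
split => //.
  apply: (@mem_clarke_subdiff _ _ _ ((rho + 2) / 2)) => z.
  have := ymin z.
  have -> : z - x = (z - y) - (x - y) by rewrite opprB addrA subrK.
  have -> : y - x = - (x - y) by rewrite opprB.
  set p := z - y; set q := x - y; clearbody p q.
  by rewrite !dotE (dotC p q); lra.
rewrite enormZ ger0_norm ?addr_ge0// enormB -mulrA ler_wpM2l// addr_ge0//.
Qed.

End ProxLinearStep.

(** * Error bound and directions of the composite model *)

Section ErrorBound.
Context {R : realType}.

Lemma nbhs_enorm n (x : 'rV[R]_n) (A : set 'rV[R]_n) : nbhs x A ->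
  exists2 e : R, 0 < e & forall z, enorm (z - x) < e -> A z.
Proof.
move=> /nbhs_ballP[e /= e0 eA]; exists e => // z zx; apply: eA.
by rewrite -ball_normE /ball_ /= distrC (le_lt_trans (norm_le_enorm _)).
Qed.

Lemma edist_set_lt n (x : 'rV[R]_n) A r : (edist_set x A < r%:E)%E ->
  exists2 z, A z & enorm (x - z) < r.
Proof. by move=> /ereal_inf_lt[_ [z Az <-]]; rewrite lte_fin; exists z. Qed.

Lemma edist_set_le n (x z : 'rV[R]_n) A : A z ->
  (edist_set x A <= (enorm (x - z))%:E)%E.
Proof. by move=> Az; apply: ereal_inf_lbound; exists z. Qed.

(** Near a stationary point, subregularity applied at the nearby point with a
  small subgradient turns the residual bound into a distance bound. Near a
  non-stationary point, small residuals do not occur at all, because the global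
  quadratic support property would pass to the limit. Compactness makes both
  constants uniform. *)
Lemma error_bound_compact n (f : 'rV[R]_n -> R)
    (phi : 'rV[R]_n -> 'rV[R]_n -> R) (rho b E : R) (X : set 'rV[R]_n) :
  0 <= rho -> 0 <= E ->
  (forall x z, `|phi x z - f z| <= rho / 2 * dot (z - x) (z - x)) ->
  weakly_convex rho f -> continuous f -> (forall z, b <= f z) ->
  compact X ->
  (forall p, (inv_setmap (clarke_subdiff f) 0 `&` X) p ->
     metrically_subregular (clarke_subdiff f) p 0) ->
  exists K : R, 0 < K /\ forall x eps g, X x -> 0 < eps -> eps <= E ->
    prox_grad (phi x) x eps g -> K * enorm g <= 1 ->
    exists2 z, clarke_subdiff f z 0 & enorm (z - x) <= K * enorm g.
Proof.
move=> rho0 E0 err wf cf fb cX subreg.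
pose D := 1 + (rho + 1) * E; pose C := (rho + 2) * D.
have D0 : 0 < D by rewrite /D ltr_wpDr// mulr_ge0// addr_ge0.
have C0 : 0 < C by rewrite /C mulr_gt0// ltr_wpDl.
(* A single integer serves as the bound on the distance ratio and as the inverse
   of the residual threshold. *)
pose P N x := forall (eps : R) g, 0 < eps -> eps <= E ->
  prox_grad (phi x) x eps g -> N.+1%:R * enorm g <= 1 ->
  exists2 z, clarke_subdiff f z 0 & enorm (z - x) <= N%:R * enorm g.
suff : \forall N \near \oo, X `<=` P N.
  move=> [N _ /(_ N (leqnn N)) XP]; exists N.+1%:R; split; first by rewrite ltr0n.
  move=> x eps g Xx eps0 epsE gP gN; have [z zc zx] := XP x Xx eps g eps0 epsE gP gN.
  by exists z => //; rewrite (le_trans zx)// ler_wpM2r ?enorm_ge0// ler_nat.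
move/compact_near_coveringP : cX; apply => p Xp.
suff [d [r [d0 loc]]] : exists d r : R, 0 < d /\
    forall (x : 'rV[R]_n) N, enorm (x - p) < d -> r <= N%:R -> P N x.
  exists ([set x | enorm (x - p) < d], [set N | r <= N%:R]) => /=.
    by split; [exact: near_enorm | exact: nbhs_infty_ger].
  by move=> [x N] [/= xp rN]; exact: loc.
have near_stat x eps g : 0 < eps -> eps <= E -> prox_grad (phi x) x eps g ->
    exists y v, [/\ clarke_subdiff f y v, enorm (y - x) <= D * enorm g &
      enorm v <= C * enorm g].
  move=> eps0 epsE gP.
  exact: (prox_grad_near_stationary rho0 (err x) eps0 gP cf fb epsE).
have [pcrit|pncrit] := pselect (clarke_subdiff f p 0).
  have [_ [kappa [tau [kappa0 tau0 sub]]]] := subreg p (conj pcrit Xp).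
  exists (tau / 2), (kappa * C + 1 + D + 2 * D / tau); split.
    by rewrite divr_gt0.
  move=> x N xp rN eps g eps0 epsE gP gN.
  have [y [v [yv yx vg]]] := near_stat x eps g eps0 epsE gP.
  have Dt : 0 < 2 * D / tau by rewrite divr_gt0// mulr_gt0.
  have kC : 0 < kappa * C by rewrite mulr_gt0.
  (* A zero residual leaves no slack for an approximate nearest point, but then
     [x] is itself stationary. *)
  have := enorm_ge0 g; rewrite le_eqVlt => /predU1P[g0|g0].
    move: yx vg; rewrite -g0 !mulr0 => yx vg.
    have /enorm_eq0/eqP : enorm (y - x) = 0 by apply/le_anti; rewrite yx enorm_ge0.
    rewrite subr_eq0 => /eqP yE.
    have /enorm_eq0 vE : enorm v = 0 by apply/le_anti; rewrite vg enorm_ge0.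
    by exists x; [rewrite -yE -vE | rewrite subrr enorm0].
  have yp : enorm (y - p) < tau.
    have Dg : 2 * D / tau * enorm g < 1.
      apply: lt_le_trans gN; rewrite ltr_pM2r//.
      by rewrite (@le_lt_trans _ _ N%:R) ?ltr_nat//; lra.
    have {}Dg : D * enorm g < tau / 2.
      by move: Dg; rewrite mulrAC ltr_pdivrMr//; lra.
    by have := enorm_trans x y p; lra.
  have := sub y yp => dist_le.
  have [z zc zy] : exists2 z, clarke_subdiff f z 0
      & enorm (y - z) < (kappa * C + 1) * enorm g.
    apply: edist_set_lt; apply: (le_lt_trans dist_le).
    apply: (@le_lt_trans _ _ (kappa%:E * (enorm (0 - v))%:E)%E).
      by rewrite lee_pmul2l ?lte_fin//; exact: edist_set_le.
    rewrite -EFinM lte_fin sub0r enormN.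
    by have := ler_wpM2l (ltW kappa0) vg; lra.
  exists z => //; rewrite enormB.
  have := enorm_trans y x z; rewrite (enormB x y).
  have := ler_wpM2r (ltW g0) rN.
  have := mulr_gt0 Dt g0; lra.
have [w fw] : exists w, f w < f p - rho / 2 * dot (w - p) (w - p).
  apply/not_existsP => H; apply: pncrit.
  apply: (@mem_clarke_subdiff _ _ _ (rho / 2)) => z.
  by rewrite dot0l addr0 leNgt; apply/negP; exact: H.
pose Q y := f y - rho / 2 * enorm (y - w) ^+ 2.
have cQ : continuous Q.
  move=> y; pose T (u : 'rV[R]_n) := rho / 2 * enorm (u - w) ^+ 2.
  apply: (@continuousB _ _ _ f T y (cf y)).
  apply: continuousM; first exact: cst_continuous.
  by apply: continuousM; exact: enorm_continuous.
pose e := (Q p - f w) / 2.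
have e0 : 0 < e by rewrite /e /Q enormB enorm_sqr; lra.
have [d d0 Qd] : exists2 d, 0 < d & forall y, enorm (y - p) < d -> `|Q p - Q y| < e.
  by apply: nbhs_enorm; exact: (@cvgr_dist_lt _ _ _ (nbhs p) _ _ _ (cQ p) e e0).
pose W := enorm (p - w) + d.
have W0 : 0 < W by rewrite /W ltr_wpDl ?enorm_ge0.
exists (d / 2), (2 * D / d + C * W / e); split; first by rewrite divr_gt0.
move=> x N xp rN eps g eps0 epsE gP gN; exfalso.
have [y [v [yv yx vg]]] := near_stat x eps g eps0 epsE gP.
have Dd : 0 <= 2 * D / d by rewrite divr_ge0 ?ltW// mulr_gt0.
have CW : 0 <= C * W / e by rewrite divr_ge0 ?ltW// mulr_gt0.
have g0 := enorm_ge0 g.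
have NN : N.+1%:R = N%:R + 1 :> R by rewrite -natr1.
have yp : enorm (y - p) < d.
  have Dg : 2 * D / d * enorm g <= 1.
    by apply: le_trans gN; rewrite ler_wpM2r//; lra.
  have {}Dg : D * enorm g <= d / 2.
    by move: Dg; rewrite mulrAC ler_pdivrMr//; lra.
  by have := enorm_trans x y p; lra.
have vW : enorm v * W <= e.
  have : C * W / e * enorm g <= 1.
    by apply: le_trans gN; rewrite ler_wpM2r//; lra.
  rewrite mulrAC ler_pdivrMr// mul1r mulrAC; apply: le_trans.
  by rewrite ler_wpM2r// ltW.
have yw : enorm (w - y) <= W.
  by rewrite enormB (le_trans (enorm_trans p y w))// /W addrC lerD2l ltW.
have := clarke_subdiff_ge rho0 cf wf yv w.
have := cauchy_schwarz (- v) (w - y); rewrite dotNl enormN.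
have := ler_wpM2l (enorm_ge0 v) yw.
have := Qd y yp; rewrite ltr_norml => /andP[_].
have eE : e * 2 = Q p - f w by rewrite divfK.
rewrite -enorm_sqr (enormB w y) => h1 h2 h3 h4.
have QyE : Q y = f y - rho / 2 * enorm (y - w) ^+ 2 by [].
move: h1; rewrite QyE; clearbody e Q W; lra.
Qed.

End ErrorBound.

Section CompositeProxGrad.
Context {R : realType}.

Lemma G_composite_prox_grad n m (h : 'rV[R]_m -> R)
    (c : 'rV[R]_n -> 'rV[R]_m) (L b : R) :
  convex_function [set: 'rV[R]_m] h -> 0 <= L ->
  (forall u v, `|h u - h v| <= L * enorm (u - v)) ->
  (forall z, b <= h z) ->
  forall x eps g, G_composite h c x eps g ->
    prox_grad (linmodel h c x) x eps g /\
    exists2 y, enorm y <= L & g = mxvmul (grad c x) y.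
Proof.
move=> hconv L0 hlip hb x eps g [y yarg <-].
have ysub := argmax_subgradient hconv L0 hlip hb yarg.
split; last by exists y => //; exact: subgradient_lip ysub.
move=> z; set A := grad c x; rewrite -/A in ysub; set g' := mxvmul A y.
rewrite /linmodel -/A.
have -> : x - eps *: g' - x = - (eps *: g') by rewrite addrAC subrr add0r.
rewrite mulNmx -scalemxAl; have := ysub (c x + (z - x) *m A); rewrite -/g'.
apply: le_trans; rewrite lerD2l.
have -> : c x + (z - x) *m A - (c x - eps *: (g' *m A))
    = (z - (x - eps *: g')) *m A.
  by rewrite !opprB [LHS]addrC addrA subrK [z + (_ - x)]addrCA scalemxAl -mulmxDl.
by rewrite [leRHS]dotC dot_mulmx dotC.
Qed.

Lemma G_composite_bounded n m (h : 'rV[R]_m -> R)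
    (c : 'rV[R]_n -> 'rV[R]_m) (L b beta : R) (X : set 'rV[R]_n) :
  convex_function [set: 'rV[R]_m] h -> 0 <= L ->
  (forall u v, `|h u - h v| <= L * enorm (u - v)) ->
  (forall z, b <= h z) -> 0 <= beta ->
  (forall u v, opnorm (grad c u - grad c v) <= beta * enorm (u - v)) ->
  compact X ->
  exists M, 0 < M /\ forall x eps g, X x -> G_composite h c x eps g -> enorm g <= M.
Proof.
move=> hconv L0 hlip hb beta0 clip cX.
have [[x0 X0]|Xe] := pselect (X !=set0); last first.
  by exists 1; split=> // x eps g Xx; case: Xe; exists x.
have := EVT_max_rV (ex_intro _ _ X0) cX
  (continuous_subspaceT (@enorm_continuous _ _ x0)).
move=> [x1 _ x1max].
pose B := `|opnorm (grad c x0)| + beta * enorm (x1 - x0).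
have B0 : 0 <= B by rewrite addr_ge0 ?mulr_ge0 ?enorm_ge0.
exists (B * L + 1); split; first by rewrite ltr_wpDl ?mulr_ge0.
move=> x eps g Xx /(G_composite_prox_grad hconv L0 hlip hb)[_ [y yL ->]].
rewrite (@le_trans _ _ (B * L)) ?lerDl//.
rewrite (@le_trans _ _ (B * enorm y)) ?ler_wpM2l//.
have -> : mxvmul (grad c x) y
    = mxvmul (grad c x0) y + mxvmul (grad c x - grad c x0) y.
  by rewrite /mxvmul -mulmxDr -linearD /= addrC subrK.
rewrite (le_trans (enormD _ _))// mulrDl lerD//;
  rewrite (le_trans (enorm_mxvmul _ _))// ler_wpM2r ?enorm_ge0//.
  exact: ler_norm.
by rewrite (le_trans (clip _ _))// ler_wpM2l// x1max// inE.
Qed.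

End CompositeProxGrad.

(** * Linear rate of descent sequences *)

Section DescentSequences.
Context {R : realType}.

Lemma descent_residual_small (F gam : nat -> R) (A b : R) : 0 < A ->
  (forall k, b <= F k) -> (forall k, 0 <= gam k) ->
  (forall k, F k.+1 <= F k - A * gam k ^+ 2) ->
  forall e, 0 < e -> exists N, forall k, (N <= k)%N -> gam k <= e.
Proof.
move=> A0 Fb gam0 desc e e0.
have Fdec : nonincreasing_seq F.
  apply/nonincreasing_seqP => k; apply: (le_trans (desc k)).
  by rewrite gerBl mulr_ge0 ?sqr_ge0// ltW.
have cF : cvgn F.
  by apply: nonincreasing_is_cvgn => //; exists b => _ [k _ <-].
have ge_lim k : limn F <= F k by exact: nonincreasing_cvgn_ge.
have Ae : 0 < A * e ^+ 2 by rewrite mulr_gt0// exprn_gt0.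
have [N _ NP] := @cvgr_dist_lt _ _ _ _ _ _ _ cF _ Ae.
exists N => k Nk; rewrite leNgt; apply/negP => egk.
have := NP k Nk; rewrite /= ltr_norml => /andP[lt _].
have := desc k; have := ge_lim k.+1.
have : A * e ^+ 2 <= A * gam k ^+ 2.
  by rewrite ler_pM2l// ler_pXn2r ?nnegrE// ltW.
lra.
Qed.

(** Once residuals are small, consecutive nearby stationary points are closer
  than [delta0], so they all share one critical value; the remaining optimality
  gap is then bounded by the last decrease, which contracts it. *)
Lemma linear_rate n (f : 'rV[R]_n -> R) (x : nat -> 'rV[R]_n) (gam : nat -> R)
    (S X : set 'rV[R]_n) (A B E K delta0 rho b : R) :
  0 < A -> 0 < B -> 0 < E -> 0 < K -> 0 < delta0 -> 0 <= rho ->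
  continuous f -> (forall z, b <= f z) -> compact X -> (forall k, X (x k)) ->
  (forall k, 0 <= gam k) ->
  (forall k, f (x k.+1) <= f (x k) - A * gam k ^+ 2) ->
  (forall k, enorm (x k.+1 - x k) <= E * gam k) ->
  (forall k z, enorm (z - x k) <= K * gam k ->
     f (x k.+1) <= f z + B * gam k ^+ 2) ->
  (forall k, K * gam k <= 1 ->
     exists2 z, S z & enorm (z - x k) <= K * gam k) ->
  (forall z w, S z -> f z - rho / 2 * dot (w - z) (w - z) <= f w) ->
  (forall u v, S u -> S v -> f u <> f v -> delta0 <= enorm (u - v)) ->
  exists (xbar : 'rV[R]_n) (q r C : R) (N : nat),
    [/\ 0 < q < 1, 0 < r < 1, 0 < C &
      forall k, (N <= k)%N ->
        f (x k.+1) - f xbar <= q * (f (x k) - f xbar) /\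
        enorm (x k - xbar) <= C * r ^+ k].
Proof.
move=> A0 B0 E0 K0 d0 rho0 cf fb cX Xx gam0 desc step near_opt eb supp sep.
have small := @descent_residual_small (f \o x) gam A b A0
  (fun k => fb (x k)) gam0 desc.
(* The second bound makes room, within [delta0], for two distances to stationary
   points and one step. *)
pose e0 := Num.min (K^-1) (delta0 / (2 * (2 * K + E))).
have KE : 0 < 2 * (2 * K + E) by lra.
have e0_gt0 : 0 < e0 by rewrite /e0 lt_min invr_gt0 K0 divr_gt0.
have [N0 N0P] := small e0 e0_gt0.
have small1 k : (N0 <= k)%N -> K * gam k <= 1.
  move=> /N0P; rewrite /e0 le_min => /andP[+ _].
  by rewrite -(ler_pM2l K0) mulfV ?gt_eqF.
have small2 k : (N0 <= k)%N -> 2 * (2 * K + E) * gam k <= delta0.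
  move=> /N0P; rewrite /e0 le_min => /andP[_].
  by rewrite ler_pdivlMr// mulrC.
have [z zP] : exists z : nat -> 'rV[R]_n, forall k, (N0 <= k)%N ->
    S (z k) /\ enorm (z k - x k) <= K * gam k.
  suff : forall k, exists y, (N0 <= k)%N -> S y /\ enorm (y - x k) <= K * gam k.
    by move=> /choice[z zP]; exists z.
  move=> k; have [Nk|_] := leqP N0 k; last by exists 0.
  by have [y Sy yx] := eb k (small1 k Nk); exists y.
have fz k : (N0 <= k)%N -> f (z k.+1) = f (z k).
  move=> Nk; apply: contrapT => neq.
  have := sep _ _ (zP _ (leqW Nk)).1 (zP _ Nk).1 neq.
  have [_ z1] := zP _ (leqW Nk); have [_ z2] := zP _ Nk.
  apply/negP; rewrite -ltNge.
  have := enorm_trans (x k.+1) (z k.+1) (z k).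
  have := enorm_trans (x k) (x k.+1) (z k); rewrite (enormB (x k)).
  have := step k; have := small2 k Nk; have := small2 _ (leqW Nk).
  have := mulr_ge0 (ltW K0) (gam0 k).
  have := mulr_ge0 (ltW E0) (gam0 k); have := mulr_ge0 (ltW E0) (gam0 k.+1).
  lra.
pose fs := f (z N0).
have {}fz k : (N0 <= k)%N -> f (z k) = fs.
  move=> /subnK <-; elim: (k - N0)%N => [|j IH]; first by rewrite add0n.
  by rewrite addSn fz ?leq_addl.
pose D k := f (x k) - fs.
have Ddec k : D k.+1 <= D k - A * gam k ^+ 2 by rewrite /D; have := desc k; lra.
have Dup k : (N0 <= k)%N -> D k.+1 <= B * gam k ^+ 2.
  move=> Nk; have [_ zx] := zP k Nk.
  by have := near_opt k _ zx; rewrite fz// /D; lra.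
have Dlow k : (N0 <= k)%N -> - (rho / 2 * K ^+ 2 * gam k ^+ 2) <= D k.
  move=> Nk; have [Sz zx] := zP k Nk.
  have := supp _ (x k) Sz; rewrite fz// -enorm_sqr enormB.
  have : enorm (z k - x k) ^+ 2 <= (K * gam k) ^+ 2.
    by rewrite ler_pXn2r ?nnegrE ?enorm_ge0 ?mulr_ge0// ltW.
  by move=> /(ler_wpM2l (_ : 0 <= rho / 2)); rewrite divr_ge0// => /(_ isT);
    rewrite /D; lra.
have Dmono k j : D (k + j)%N <= D k.
  elim: j => [|j IH]; first by rewrite addn0.
  rewrite addnS; apply: le_trans IH; apply: (le_trans (Ddec _)).
  by rewrite gerBl mulr_ge0 ?sqr_ge0// ltW.
(* The gap never increases, and [Dlow] keeps its limit nonnegative. *)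
have D0 k : (N0 <= k)%N -> 0 <= D k.
  move=> Nk; rewrite leNgt; apply/negP => Dk.
  pose c := rho / 2 * K ^+ 2 + 1.
  have c0 : 0 < c by rewrite /c ltr_wpDl// mulr_ge0 ?sqr_ge0// divr_ge0.
  have m0 : 0 < Num.min 1 (- D k / c) by rewrite lt_min ltr01 divr_gt0// oppr_gt0.
  have [M MP] := small _ m0.
  have := MP (k + M)%N (leq_addl _ _); rewrite le_min => /andP[g1 g2].
  have g0 := gam0 (k + M)%N.
  have := Dlow _ (leq_trans Nk (leq_addr M k)); have := Dmono k M.
  rewrite ler_pdivlMr// in g2.
  have [gz|gp] := eqVneq (gam (k + M)%N) 0.
    by rewrite gz expr0n mulr0; lra.
  have gp' : 0 < gam (k + M)%N by rewrite lt_def gp.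
  have : gam (k + M)%N ^+ 2 <= gam (k + M)%N by rewrite expr2 ler_piMl.
  move=> /(ler_wpM2l (ltW c0)); rewrite /c; rewrite /c in g2.
  have := exprn_gt0 2 gp'; lra.
pose q := B / (A + B).
have AB : 0 < A + B by rewrite addr_gt0.
have q01 : 0 < q < 1.
  by rewrite divr_gt0//= ltr_pdivrMr// mul1r ltrDr.
have Dq k : (N0 <= k)%N -> D k.+1 <= q * D k.
  move=> Nk; rewrite mulrAC ler_pdivlMr//.
  have := ler_wpM2l (ltW B0) (Ddec k).
  have := ler_wpM2l (ltW A0) (Dup k Nk); lra.
have /andP[q0 q1] := q01.
have Dgeo j : D (N0 + j)%N <= q ^+ j * D N0.
  elim: j => [|j IH]; first by rewrite addn0 mul1r.
  rewrite addnS (le_trans (Dq _ (leq_addr _ _)))// exprS -mulrA.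
  by rewrite ler_pM2l.
(* Step lengths are of the order of the square root of the gap. *)
pose r := Num.sqrt q.
have r0 : 0 < r by rewrite sqrtr_gt0.
have rq : r ^+ 2 = q by rewrite sqr_sqrtr// ltW.
have r1 : r < 1 by rewrite -(ltr_pXn2r (ltn0Sn 1)) ?nnegrE ?ltW// rq expr1n.
pose c := E * Num.sqrt (D N0 / A).
have c0 : 0 <= c by rewrite mulr_ge0 ?sqrtr_ge0// ltW.
have stepgeo j : enorm (x (N0 + j).+1 - x (N0 + j)%N) <= c * r ^+ j.
  apply: (le_trans (step _)); rewrite /c -mulrA ler_pM2l//.
  rewrite -(ler_pXn2r (ltn0Sn 1)) ?nnegrE ?mulr_ge0 ?sqrtr_ge0 ?exprn_ge0 ?(ltW r0)//.
  rewrite exprMn sqr_sqrtr ?divr_ge0 ?D0 ?(ltW A0)// -exprM mulnC exprM rq.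
  rewrite mulrAC ler_pdivlMr// mulrC [leRHS]mulrC.
  apply: le_trans (Dgeo j).
  have := Ddec (N0 + j)%N; have := D0 _ (leqW (leq_addr j N0)); lra.
pose c' := c / (1 - r).
have r1' : 0 < 1 - r by rewrite subr_gt0.
have c'0 : 0 <= c' by rewrite divr_ge0// ltW.
have tail j l : enorm (x (N0 + j + l)%N - x (N0 + j)%N)
    <= c' * (r ^+ j - r ^+ (j + l)).
  elim: l => [|l IH]; first by rewrite !addn0 !subrr enorm0 mulr0.
  apply: (le_trans (enorm_trans (x (N0 + j + l)%N) _ _)).
  have := stepgeo (j + l)%N; rewrite addnA -addnS => st.
  have -> : c' * (r ^+ j - r ^+ (j + l.+1))
      = c * r ^+ (j + l) + c' * (r ^+ j - r ^+ (j + l)).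
    by rewrite addnS exprS /c'; field; rewrite gt_eqF.
  exact: lerD.
(* A cluster point suffices, since [tail] bounds the distance between any two late
   iterates. *)
have [xbar [_ xbar_cl]] := cX (x @ \oo) _ (ex_intro2 _ _ 0%N I (fun k _ => Xx k)).
have freq e M : 0 < e -> exists2 k, (M <= k)%N & enorm (x k - xbar) < e.
  move=> e1.
  have [|_ [[k Mk <-] ke]] := xbar_cl (x @` [set k | (M <= k)%N])
    [set y | enorm (y - xbar) < e] _ (near_enorm xbar e1).
    by exists M => // k Mk; exists k.
  by exists k.
have xgeo j : enorm (x (N0 + j)%N - xbar) <= c' * r ^+ j.
  apply/ler_addgt0Pr => e e1.
  have [k jk ke] := freq e (N0 + j)%N e1.
  have := tail j (k - (N0 + j))%N; rewrite subnKC// enormB => tl.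
  have := enorm_trans (x k) (x (N0 + j)%N) xbar.
  have := mulr_ge0 c'0 (exprn_ge0 (j + (k - (N0 + j)))%N (ltW r0)); lra.
have fbar : f xbar = fs.
  apply/eqP; rewrite -subr_eq0 -normr_le0; apply/ler_addgt0Pr => e e1.
  rewrite add0r.
  have e2 : 0 < e / 2 by rewrite divr_gt0.
  have [d dd dP] : exists2 d, 0 < d & forall y, enorm (y - xbar) < d ->
      `|f xbar - f y| < e / 2.
    by apply: nbhs_enorm; exact: (@cvgr_dist_lt _ _ _ (nbhs xbar) _ _ _ (cf xbar)).
  have m0 : 0 < Num.min 1 (e / 2 / B) by rewrite lt_min ltr01 divr_gt0.
  have [M MP] := small _ m0.
  have [[|k]] := freq d (maxn N0 M).+1 dd; first by rewrite ltn0.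
  rewrite ltnS geq_max => /andP[N0k Mk] /dP.
  have := MP k Mk; rewrite le_min ler_pdivlMr// => /andP[g1 g2].
  have := Dup k N0k; have := D0 _ (leqW N0k); rewrite /D => D0k Duk.
  have : gam k ^+ 2 <= gam k by rewrite expr2 ler_piMl.
  move=> /(ler_wpM2l (ltW B0)) gg.
  by rewrite ltr_norml ler_norml => /andP[? ?]; apply/andP; split; lra.
exists xbar, q, r, (c' / r ^+ N0 + 1), N0; split => //.
- by rewrite r0.
- by rewrite ltr_wpDl// divr_ge0// exprn_ge0// ltW.
move=> k Nk; split; first by rewrite fbar; exact: Dq.
have := xgeo (k - N0)%N; rewrite subnKC// => /le_trans; apply.
rewrite mulrDl mul1r.
have -> : c' / r ^+ N0 * r ^+ k = c' * r ^+ (k - N0).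
  by rewrite -{1}(subnK Nk) exprD; field; rewrite expf_neq0// gt_eqF.
by rewrite lerDl exprn_ge0// ltW.
Qed.

End DescentSequences.

(** * Step sizes of the adaptive method *)

Section AdaptiveMethod.
Context {R : realType} {n : nat}.
Context {f : 'rV[R]_n -> R} {phi : 'rV[R]_n -> 'rV[R]_n -> R}.
Context {G : 'rV[R]_n -> R -> set 'rV[R]_n} {rho alpha : R}.
Hypothesis rho_gt0 : 0 < rho.
Hypothesis alpha01 : 0 < alpha < 1.
Hypothesis model_error :
  forall x z, `|phi x z - f z| <= rho / 2 * dot (z - x) (z - x).
Hypothesis G_prox_grad : forall x eps g, G x eps g -> prox_grad (phi x) x eps g.

(** Short proximal steps always pass the descent test, so backtracking
  halves at most once below the threshold [2 * (1 - alpha) / rho]. *)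
Lemma inner_loop_bounds x eps0 g i eta : 0 < eps0 ->
  inner_loop f G alpha x eps0 g i eta ->
  let e := eps0 / 2 ^+ i in
  [/\ G x e (g i), Num.min eps0 ((1 - alpha) / rho) <= e <= eps0,
    0 <= eta <= eps0, f (x - eta *: g i) <= f (x - e *: g i) &
    f (x - eta *: g i) <= f x - alpha * e * enorm (g i) ^+ 2].
Proof.
move=> eps0_gt0 [/= Gg fail [j [ji desc _ [[l /andP[jl li] ->] etamin]]]].
have [a0 a1] := andP alpha01; have rho0 := ltW rho_gt0.
have pow2 k : 0 < 2 ^+ k :> R by rewrite exprn_gt0.
have step_gt0 k : 0 < eps0 / 2 ^+ k by rewrite divr_gt0.
have step_mono k k' : (k <= k')%N -> eps0 / 2 ^+ k' <= eps0 / 2 ^+ k.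
  move=> kk; rewrite ler_pM2l// lef_pV2 ?posrE//.
  by rewrite ler_weXn2l ?ler1n.
have step_le k : eps0 / 2 ^+ k <= eps0.
  by have := step_mono 0 k (leq0n _); rewrite expr0 divr1.
have low : Num.min eps0 ((1 - alpha) / rho) <= eps0 / 2 ^+ i.
  case: i Gg fail {ji desc li etamin} => [|i] Gg fail.
    by rewrite expr0 divr1 ge_min lexx.
  rewrite ge_min; apply/orP; right; rewrite leNgt; apply/negP => short.
  apply: (fail i (ltnSn i) i (leqnn i)); rewrite /descent.
  have gP := G_prox_grad (Gg i (leqnSn i)).
  apply: (le_trans (prox_grad_decrease (model_error x) gP)).
  rewrite lerD2l lerN2 ler_wpM2r ?sqr_ge0// mulrC ler_wpM2l ?(ltW (step_gt0 i))//.
  move: short; rewrite exprSr invfM mulrA ltr_pdivlMr//; lra.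
split.
- exact: Gg.
- by rewrite low step_le.
- by rewrite step_le ltW.
- by apply: etamin; rewrite ji leqnn.
- apply: (le_trans (etamin j _)); first by rewrite leqnn ji.
  apply: (le_trans desc); rewrite lerD2l lerN2 ler_wpM2r ?sqr_ge0//.
  by rewrite ler_pM2l// step_mono.
Qed.

End AdaptiveMethod.

Section RatioTest.
Context {R : realType}.

(** Along the proximal path the residual decreases and the step length increases
  with the parameter. So [enorm gt <= enorm g] if [e1 <= r], and
  [r * enorm gt <= e1 * enorm g] otherwise; in both cases the square of the left
  side carries a further factor that is small with [r]. *)
Lemma ratio_test_passes n (phi : 'rV[R]_n -> R) x (eps0 e1 r c0 E M : R) g gt :
  0 < eps0 -> eps0 <= E -> 0 < e1 -> c0 * eps0 <= e1 ->
  0 < r -> r <= 1 -> 0 < M -> E * M * r <= c0 -> E ^+ 2 * M * r <= 1 ->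
  prox_grad phi x e1 g -> prox_grad phi x r gt -> enorm gt <= M ->
  eps0 * r * enorm gt <= Num.sqrt (e1 * enorm g).
Proof.
move=> eps0_gt0 epsE e10 ce r0 r1 M0 small1 small2 gP gtP gtM.
have G0 := enorm_ge0 gt; have g0 := enorm_ge0 g.
have er0 : 0 <= eps0 * r by rewrite ltW// mulr_gt0.
rewrite -(ler_pXn2r (ltn0Sn 1)) ?nnegrE ?sqrtr_ge0 ?(mulr_ge0 er0)//.
rewrite sqr_sqrtr ?mulr_ge0 ?(ltW e10)//.
have [e1r|re1] := leP e1 r.
  have [Gg _] := prox_grad_monotone e10 e1r gP gtP.
  have EM : eps0 * enorm gt <= E * M by rewrite ler_pM// ltW.
  have rr : r ^+ 2 <= r by rewrite expr2 ler_piMl// ltW.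
  have EMr : eps0 * enorm gt * r ^+ 2 <= c0.
    by apply: le_trans small1; rewrite ler_pM ?sqr_ge0// mulr_ge0// ltW.
  apply: (@le_trans _ _ (e1 * enorm gt)); last by rewrite ler_pM2l.
  apply: (@le_trans _ _ (c0 * eps0 * enorm gt)); last by rewrite ler_wpM2r.
  have -> : (eps0 * r * enorm gt) ^+ 2
      = eps0 * enorm gt * r ^+ 2 * (eps0 * enorm gt) by ring.
  by rewrite -[leRHS]mulrA ler_wpM2r// mulr_ge0// ltW.
have [_ ge] := prox_grad_monotone r0 (ltW re1) gtP gP.
apply: le_trans ge.
have EE : eps0 ^+ 2 * enorm gt <= E ^+ 2 * M.
  rewrite ler_pM ?sqr_ge0// ler_pXn2r ?nnegrE// ?(le_trans _ epsE)// ltW//.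
have EEr : eps0 ^+ 2 * enorm gt * r <= 1.
  by apply: le_trans small2; rewrite ler_pM2r.
have -> : (eps0 * r * enorm gt) ^+ 2
    = eps0 ^+ 2 * enorm gt * r * (r * enorm gt) by ring.
by rewrite -[leRHS]mul1r ler_wpM2r// mulr_ge0// ltW.
Qed.

End RatioTest.

Section StepSizes.
Context {R : realType} {n : nat}.
Context {f : 'rV[R]_n -> R} {phi : 'rV[R]_n -> 'rV[R]_n -> R}.
Context {G : 'rV[R]_n -> R -> set 'rV[R]_n} {rho alpha : R}.
Hypothesis rho_gt0 : 0 < rho.
Hypothesis alpha01 : 0 < alpha < 1.
Hypothesis model_error :
  forall x z, `|phi x z - f z| <= rho / 2 * dot (z - x) (z - x).
Hypothesis G_prox_grad : forall x eps g, G x eps g -> prox_grad (phi x) x eps g.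

(** Only a failed ratio test shrinks the initial trial step, and tests fail only
  while the counter is below the threshold after which [a] is small; so the
  steps stay bounded away from zero. *)
Lemma generated_steps (a : nat -> R) theta_eps theta_nu x0 E nu0 M x :
  0 < E -> (forall t, 0 < a t) -> a @ \oo --> 0 -> 0 < theta_eps < 1 ->
  0 < M -> (forall x eps g, f x <= f x0 -> G x eps g -> enorm g <= M) ->
  generated f G a theta_eps theta_nu alpha x0 E nu0 x ->
  exists2 emin, 0 < emin & forall k, f (x k) <= f x0 /\
    exists g e, [/\ prox_grad (phi (x k)) (x k) e g, emin <= e <= E,
      f (x k.+1) <= f (x k - e *: g),
      f (x k.+1) <= f (x k) - alpha * e * enorm g ^+ 2 &
      enorm (x k.+1 - x k) <= E * enorm g].
Proof.
move=> E0 a_gt0 a0 /andP[th0 th1] M0 GM [s [s0 sstep sx]].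
have [al0 al1] := andP alpha01.
pose c0 := Num.min 1 ((1 - alpha) / rho / E).
have c00 : 0 < c0.
  by rewrite /c0 lt_min ltr01/= !divr_gt0// subr_gt0.
have c0P eps0 : 0 < eps0 -> eps0 <= E ->
    c0 * eps0 <= Num.min eps0 ((1 - alpha) / rho).
  move=> e0 eE; rewrite le_min; apply/andP; split.
    by rewrite ler_piMl ?(ltW e0)// ge_min lexx.
  apply: (@le_trans _ _ (c0 * E)); first by rewrite ler_pM2l.
  by rewrite -ler_pdivlMr// ge_min lexx orbT.
pose r0 := Num.min 1 (Num.min (c0 / (E * M)) ((E ^+ 2 * M)^-1)).
have EM : 0 < E * M by rewrite mulr_gt0.
have EEM : 0 < E ^+ 2 * M by rewrite mulr_gt0// exprn_gt0.
have r00 : 0 < r0 by rewrite /r0 !lt_min ltr01 divr_gt0// invr_gt0.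
have [T Tsmall] : exists T, forall t, (T <= t)%N -> a t `^ 4^-1 <= r0.
  have r04 : 0 < r0 ^+ 4 by rewrite exprn_gt0.
  have [T _ TP] := @cvgr_dist_lt _ _ _ _ _ _ _ a0 _ r04.
  exists T => t Tt; have := TP t Tt; rewrite /= sub0r normrN gtr0_norm// => at4.
  have -> : r0 = (r0 ^+ 4) `^ 4^-1.
    by rewrite -powR_mulrn ?(ltW r00)// -powRrM mulfV ?powRr1// ltW.
  by apply: ge0_ler_powR; rewrite ?invr_ge0// ?nnegrE ltW.
(* The exponent counts the tests that may have failed: from counter value [T] on,
   none does. *)
pose I k := [/\ f (st_x (s k)) <= f x0, 0 < st_eps (s k) <= E &
  E * theta_eps ^+ minn (st_t (s k)) T <= st_eps (s k)].
have Istep k : I k -> I k.+1 /\ exists g e,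
    [/\ prox_grad (phi (x k)) (x k) e g, c0 * st_eps (s k) <= e <= E,
      f (x k.+1) <= f (x k - e *: g),
      f (x k.+1) <= f (x k) - alpha * e * enorm g ^+ 2 &
      enorm (x k.+1 - x k) <= E * enorm g].
  move=> [fk /andP[e0 eE] lowk].
  have [g [i [eta [inner xS upd]]]] := sstep k.
  have /= := inner_loop_bounds rho_gt0 alpha01 model_error G_prox_grad e0 inner.
  set e := st_eps (s k) / 2 ^+ i => -[Gg /andP[elow eup] /andP[eta0 etaE] fe fdesc].
  have gP := G_prox_grad Gg.
  have ce := le_trans (c0P _ e0 eE) elow.
  have epos : 0 < e by rewrite divr_gt0// exprn_gt0.
  have fS : f (st_x (s k.+1)) <= f (st_x (s k)).
    rewrite xS (le_trans fdesc)// gerBl mulr_ge0 ?sqr_ge0//.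
    by rewrite mulr_ge0 ?(ltW al0) ?(ltW epos).
  split; last first.
    exists (g i), e; rewrite !sx xS; split=> //.
      by rewrite ce (le_trans eup).
    rewrite addrAC subrr add0r enormN enormZ ger0_norm//.
    by rewrite ler_wpM2r ?enorm_ge0// (le_trans etaE).
  have fS0 := le_trans fS fk.
  have shrink : 0 < theta_eps * st_eps (s k) <= E.
    rewrite mulr_gt0//= (le_trans _ eE)// ler_piMl// ltW//.
  case: ifP upd => [_ [gt [Ggt tS _ epsS]]|_ [tS _ epsS]]; last first.
    by split; rewrite ?tS ?epsS ?e0.
  have [Tt|tT] := leqP T (st_t (s k)).+1.
    have small := Tsmall _ Tt.
    have r_gt0 : 0 < a (st_t (s k)).+1 `^ 4^-1 by rewrite powR_gt0.
    move: small; rewrite !le_min => /and3P[r1 rc rE].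
    have := ratio_test_passes e0 eE epos ce r_gt0 r1 M0 _ _ gP
      (G_prox_grad Ggt) (GM _ _ _ fk Ggt).
    rewrite mulrC -ler_pdivlMr// [E ^+ 2 * M * _]mulrC -ler_pdivlMr// mul1r.
    move=> /(_ rc rE) pass; move: epsS; rewrite pass => epsS.
    split; rewrite ?epsS ?e0 ?eE//; apply: le_trans lowk.
    rewrite ler_pM2l// tS ler_wiXn2l ?(ltW th0) ?(ltW th1)//.
    by rewrite leq_min !geq_min leqnSn leqnn orbT.
  split=> //; first by rewrite epsS; case: ifP; rewrite ?e0 ?eE.
  have tE : minn (st_t (s k)).+1 T = (minn (st_t (s k)) T).+1.
    by rewrite !(minn_idPl _)// ltnW// ltnW.
  rewrite tS tE exprS mulrCA.
  have le : theta_eps * (E * theta_eps ^+ minn (st_t (s k)) T)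
      <= theta_eps * st_eps (s k) by rewrite ler_pM2l.
  rewrite epsS; case: ifP => _ //; apply: (le_trans le).
  by rewrite ler_piMl// ltW.
have Iall k : I k.
  elim: k => [|k IH]; last exact: (Istep k IH).1.
  by split; rewrite s0 /= ?E0 ?lexx// min0n expr0 mulr1.
have thT : 0 < theta_eps ^+ T by rewrite exprn_gt0.
exists (c0 * (E * theta_eps ^+ T)) => [|k].
  by rewrite !mulr_gt0.
have [_ [g [e [gP /andP[elow eup] fe fd dx]]]] := Istep k (Iall k).
have [fk _ lowk] := Iall k.
split; first by rewrite sx.
exists g, e; split=> //; rewrite eup andbT; apply: le_trans elow.
rewrite ler_pM2l//; apply: le_trans lowk; rewrite ler_pM2l//.
by rewrite ler_wiXn2l ?(ltW th0) ?(ltW th1)// geq_minr.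
Qed.

End StepSizes.

(** * Linear convergence *)

Theorem corollary2 (R : realType) (n m : nat)
  (c : 'rV[R]_n -> 'rV[R]_m) (h : 'rV[R]_m -> R) (f : 'rV[R]_n -> R)
  (beta L delta0 : R)
  (x0 : 'rV[R]_n) (eps00 nu0 theta_eps theta_nu alpha : R) (a : nat -> R)
  (x : nat -> 'rV[R]_n)
  (f_def : f = h \o c)
  (c_C1 : C1 c)
  (beta_gt0 : 0 < beta)
  (grad_lip : forall u v, opnorm (grad c u - grad c v) <= beta * enorm (u - v))
  (h_convex : convex_function [set: 'rV[R]_m] h)
  (L_gt0 : 0 < L)
  (h_lip : forall u v, `|h u - h v| <= L * enorm (u - v))
  (h_bounded : (-oo < ereal_inf [set (h y)%:E | y in [set: 'rV[R]_m]])%E)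
  (delta0_gt0 : 0 < delta0)
  (crit_sep : forall u v,
     inv_setmap (clarke_subdiff f) 0 u -> inv_setmap (clarke_subdiff f) 0 v ->
     f u <> f v -> delta0 <= enorm (u - v))
  (eps00_gt0 : 0 < eps00)
  (a_gt0 : forall t, 0 < a t)
  (a_decr : nonincreasing_seq a)
  (a_cvg0 : a @ \oo --> 0)
  (a_sum : (\sum_(0 <= t <oo) (a t)%:E = +oo)%E)
  (nu0_gt0 : 0 < nu0)
  (theta_eps01 : 0 < theta_eps < 1)
  (theta_nu01 : 0 < theta_nu < 1)
  (alpha01 : 0 < alpha < 1)
  (x_gen : generated f (G_composite h c) a theta_eps theta_nu alpha
             x0 eps00 nu0 x)
  (X_compact : compact [set u | f u <= f x0])
  (f_subreg : forall xbar,
     (inv_setmap (clarke_subdiff f) 0 `&` [set u | f u <= f x0]) xbar ->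
     metrically_subregular (clarke_subdiff f) xbar 0) :
  exists (xbar : 'rV[R]_n) (q rho C : R) (r : nat),
    [/\ 0 < q < 1, 0 < rho < 1, 0 < C &
      forall k, (r <= k)%N ->
        f (x k.+1) - f xbar <= q * (f (x k) - f xbar) /\
        enorm (x k - xbar) <= C * rho ^+ k].
Proof.
subst f; have [cdiff _] := c_C1.
pose rho := L * beta; pose phi := linmodel h c.
have rho0 : 0 < rho by rewrite mulr_gt0.
have L0 := ltW L_gt0; have beta0 := ltW beta_gt0.
have [b hb] : exists b, forall z, b <= h z.
  have lb z : (ereal_inf [set (h y)%:E | y in [set: 'rV[R]_m]] <= (h z)%:E)%E.
    by apply: ereal_inf_lbound; exists z.
  exists (fine (ereal_inf [set (h y)%:E | y in [set: 'rV[R]_m]])) => z.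
  by rewrite -lee_fin fineK// fin_numElt h_bounded (le_lt_trans (lb 0))// ltry.
have err y z : `|phi y z - (h \o c) z| <= rho / 2 * dot (z - y) (z - y).
  exact: linmodel_error.
have cf : continuous (h \o c).
  move=> y; apply: continuous_comp; last exact: enorm_lip_continuous h_lip _.
  exact: differentiable_continuous.
have wf : weakly_convex rho (h \o c).
  by apply: weakly_convex_of_model err _; exact: linmodel_convex.
have fb z : b <= (h \o c) z by exact: hb.
have Gprox y eps g : G_composite h c y eps g -> prox_grad (phi y) y eps g.
  by move=> /(G_composite_prox_grad h_convex L0 h_lip hb)[].
have [M [M0 GM]] :=
  G_composite_bounded h_convex L0 h_lip hb beta0 grad_lip X_compact.
have [K [K0 eb]] := error_bound_compact (ltW rho0) (ltW eps00_gt0) err wf cf fb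
  X_compact f_subreg.
have [emin emin0 steps] := generated_steps rho0 alpha01 err Gprox eps00_gt0
  a_gt0 a_cvg0 theta_eps01 M0 GM x_gen.
have Xx k : (h \o c) (x k) <= (h \o c) x0 by have [] := steps k.
have [g gP] := choice (fun k => (steps k).2).
have [al0 _] := andP alpha01.
pose B := rho / 2 * K ^+ 2 + K + rho / 2 * eps00 ^+ 2.
have B0 : 0 < B by rewrite addr_gt0 ?mulr_gt0 ?exprn_gt0// addr_gt0 ?mulr_gt0 ?exprn_gt0.
apply: (@linear_rate _ _ (h \o c) x (fun k => enorm (g k))
  (inv_setmap (clarke_subdiff (h \o c)) 0) _ (alpha * emin) B eps00 K delta0 rho b
  _ B0 eps00_gt0 K0 delta0_gt0 (ltW rho0) cf fb X_compact Xx) => //.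
- by rewrite mulr_gt0.
- by move=> k; exact: enorm_ge0.
- move=> k; have [e [_ /andP[elow _] _ fd _]] := gP k.
  by rewrite (le_trans fd)// lerD2l lerN2 ler_wpM2r ?sqr_ge0// ler_pM2l.
- by move=> k; have [e []] := gP k.
- move=> k z zx; have [e [pg /andP[elow eup] fe _ _]] := gP k.
  have e0 : 0 < e by apply: lt_le_trans elow.
  apply: (le_trans fe).
  apply: (le_trans (prox_grad_le_near (ltW rho0) (err (x k)) e0 pg zx)).
  rewrite lerD2l ler_wpM2r ?sqr_ge0// lerD2l ler_pM2l ?divr_gt0//.
  by rewrite ler_pXn2r ?nnegrE// ltW.
- move=> k Kg; have [e [pg /andP[elow eup] _ _ _]] := gP k.
  by apply: (eb _ _ _ (Xx k) _ eup pg Kg); apply: lt_le_trans elow.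
- move=> z w zc; have := clarke_subdiff_ge (ltW rho0) cf wf zc w.
  by rewrite dot0l addr0.
Qed.
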